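(* Let $R$ be a $d\times d$ expansive integer matrix, let $B\subset\mathbb{Z}^d$ be a finite set with $0\in B$, $N:=|B|$, and suppose the self-affine measure $\mu=\mu(R,B)$ has no overlap. Assume there exist a finite set $L\subset\mathbb{Z}^d$ with $0\in L$ and complex numbers $(\alpha_l)_{l\in L}$ such that: (i) $\alpha_0=1$; (ii) the $|L|\times N$ matrix $T:=\frac{1}{\sqrt N}\left(e^{2\pi i (R^T)^{-1}l\cdot b}\,\alpha_l\right)_{l\in L,\,b\in B}$ satisfies $T^*T=I_N$ (its columns are orthonormal); (iii) the only entire function $h$ on $\mathbb{C}^d$ such that $0\le h\le 1$ on $\mathbb{R}^d$, $h(0)=1$, and $$\sum_{l\in L}|\alpha_l|^2\left|m_B\big((R^T)^{-1}(t-l)\big)\right|^2 h\big((R^T)^{-1}(t-l)\big)=h(t)\quad\text{for all } t\in\mathbb{R}^d,$$ is the constant function $1$. Then the set $$\left\{\Big(\prod_{i=0}^k\alpha_{l_i}\Big)e_{l_0+R^Tl_1+\dots+(R^T)^kl_k} : l_0\dots l_k\in\Omega(L)\right\}$$ is a Parseval frame for $L^2(\mu)$.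
   Context: A $d\times d$ real matrix is expansive if all its eigenvalues have modulus $>1$. For $b\in B$ let $\tau_b(x)=R^{-1}(x+b)$ on $\mathbb{R}^d$. The self-affine measure $\mu=\mu(R,B)$ is the unique Borel probability measure with $\mu(E)=\frac1N\sum_{b\in B}\mu(\tau_b^{-1}(E))$ for all Borel $E$; it is supported on the attractor $X_B=\{\sum_{k\ge1}R^{-k}b_k: b_k\in B\}$, the unique compact set with $X_B=\bigcup_{b\in B}\tau_b(X_B)$. $\mu$ has no overlap if $\mu(\tau_b(X_B)\cap\tau_{b'}(X_B))=0$ for all $b\neq b'$ in $B$. For $\lambda\in\mathbb{R}^d$, $e_\lambda(x)=e^{2\pi i\lambda\cdot x}$. $m_B(x)=\frac1N\sum_{b\in B}e^{2\pi i b\cdot x}$. $\Omega(L)$ is the set consisting of the empty word together with all finite words $l_0l_1\dots l_k$ ($k\ge0$) with $l_i\in L$ and $l_k\neq0$; the empty word corresponds to the element $e_0$ with weight $1$ (empty product). A family $\{f_i\}$ in a Hilbert space $H$ is a Parseval frame if $\sum_i|\langle v,f_i\rangle|^2=\|v\|^2$ for all $v\in H$. *)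

(* Defs.v *)
From HB Require Import structures.
From mathcomp Require Import all_boot all_order all_algebra.
From mathcomp Require Import complex.
From mathcomp Require Import all_classical all_reals all_analysis.
Set Implicit Arguments. Unset Strict Implicit. Unset Printing Implicit Defensive.
Import Order.TTheory GRing.Theory Num.Theory.
Import numFieldNormedType.Exports.
Local Open Scope classical_set_scope.
Local Open Scope ring_scope.

Definition Rd (R : realType) (d : nat) := g_sigma_algebraType (@open 'cV[R]_d).

Definition ivec (R : realType) (d : nat) (v : 'cV[int]_d) : 'cV[R]_d :=
  map_mx (fun k : int => k%:~R) v.
Definition imat (R : realType) (d : nat) (A : 'M[int]_d) : 'M[R]_d :=
  map_mx (fun k : int => k%:~R) A.

Definition cemb (R : realType) (d : nat) (t : 'cV[R]_d) : 'cV[complex R]_d :=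
  map_mx (fun x : R => (x%:C)%C) t.

Definition dot (R : realType) (d : nat) (x y : 'cV[R]_d) : R :=
  \sum_(i < d) x i 0 * y i 0.

Definition e2pi (R : realType) (theta : R) : complex R :=
  ((cos (2 * pi * theta)) +i* (sin (2 * pi * theta)))%C.

Definition expansive (R : realType) (d : nat) (A : 'M[int]_d) : Prop :=
  forall z : complex R,
    eigenvalue (map_mx (fun k : int => k%:~R : complex R) A) z -> 1 < `|z|.

Definition tau (R : realType) (d : nat) (A : 'M[int]_d) (b : 'cV[int]_d)
  (x : 'cV[R]_d) : 'cV[R]_d :=
  invmx (imat R A) *m (x + ivec R b).

Definition attractor (R : realType) (d : nat) (A : 'M[int]_d)
  (B : seq 'cV[int]_d) : set 'cV[R]_d :=
  [set x | exists bs : nat -> 'cV[int]_d, (forall k, bs k \in B) /\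
     ((fun n : nat => \sum_(k < n) (invmx (imat R A) ^+ k.+1 *m ivec R (bs k)))
        @ \oo --> x)].

Definition mB (R : realType) (d : nat) (B : seq 'cV[int]_d) (x : 'cV[R]_d)
  : complex R :=
  ((size B)%:R)^-1 * \sum_(b <- B) e2pi (dot (ivec R b) x).

Definition Tmat (R : realType) (d : nat) (A : 'M[int]_d) (B L : seq 'cV[int]_d)
  (alpha : 'cV[int]_d -> complex R) : 'M[complex R]_(size L, size B) :=
  \matrix_(i < size L, j < size B)
    ((((Num.sqrt ((size B)%:R : R))^-1)%:C)%C *
     e2pi (dot (invmx (imat R A)^T *m ivec R (nth 0 L i)) (ivec R (nth 0 B j))) *
     alpha (nth 0 L i)).

Definition Omega (d : nat) (L : seq 'cV[int]_d) : set (seq 'cV[int]_d) :=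
  [set w | all (fun l => l \in L) w /\ (w = [::] \/ last 0 w != 0)].

Definition freq (R : realType) (d : nat) (A : 'M[int]_d) (w : seq 'cV[int]_d)
  : 'cV[R]_d :=
  \sum_(i < size w) ((imat R A)^T ^+ i *m ivec R (nth 0 w i)).

Definition frame_elt (R : realType) (d : nat) (A : 'M[int]_d)
  (alpha : 'cV[int]_d -> complex R) (w : seq 'cV[int]_d) (x : 'cV[R]_d)
  : complex R :=
  (\prod_(l <- w) alpha l) * e2pi (dot (freq R A w) x).

Definition cabs2 (R : realType) (z : complex R) : R :=
  complex.Re z ^+ 2 + complex.Im z ^+ 2.

Definition cint (R : realType) (d : nat) (mu : {measure set (Rd R d) -> \bar R})
  (g : 'cV[R]_d -> complex R) : complex R :=
  ((Rintegral mu setT (fun x => complex.Re (g x))) +i*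
   (Rintegral mu setT (fun x => complex.Im (g x))))%C.

Definition inner (R : realType) (d : nat) (mu : {measure set (Rd R d) -> \bar R})
  (v f : 'cV[R]_d -> complex R) : complex R :=
  cint mu (fun x => v x * Num.conj (f x)).

Definition L2 (R : realType) (d : nat) (mu : {measure set (Rd R d) -> \bar R})
  (v : 'cV[R]_d -> complex R) : Prop :=
  measurable_fun [set: Rd R d] (fun x : Rd R d => complex.Re (v x)) /\
  measurable_fun [set: Rd R d] (fun x : Rd R d => complex.Im (v x)) /\
  (\int[mu]_x (cabs2 (v x))%:E < +oo)%E.

Definition parseval_frame (R : realType) (d : nat) (I : choiceType)
  (mu : {measure set (Rd R d) -> \bar R}) (Idx : set I)
  (f : I -> 'cV[R]_d -> complex R) : Prop :=
  forall v, L2 mu v ->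
    (\esum_(i in Idx) (cabs2 (inner mu v (f i)))%:E)%E =
    (\int[mu]_x (cabs2 (v x))%:E)%E.

(* Main.v *)
Require Import Defs.
From HB Require Import structures.
From mathcomp Require Import all_boot all_order all_algebra.
From mathcomp Require Import complex.
From mathcomp Require Import all_classical all_reals all_analysis.
From mathcomp Require Import measurable_realfun ring lra.
Import Order.TTheory GRing.Theory Num.Theory.
Import numFieldNormedType.Exports.
Local Open Scope classical_set_scope.
Local Open Scope ring_scope.

(** Write [P_n v] for the sum of [|<v, f_w>|^2] over the words [w] of length
    [n]. A word of length [n] is a word of [Omega L] padded with zeros, and
    padding does not change [f_w] because [alpha 0 = 1]; hence [P_n v]
    increases to the sum over [Omega L].

    With [S_l^* v = 1/N sum_b (v conj(alpha_l e_l)) o tau_b], the invariance of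
    [mu] gives [<v, f_(l w)> = <S_l^* v, f_w>] and [T^* T = 1] gives
    [sum_l |S_l^* v|^2 = |v|^2], so [P_n v <= |v|^2] by induction on [n]. Since
    [S_l^* e_t] is a multiple of [e_((A^T)^-1 (t - l))], the limit
    [h t = lim P_n e_t] solves the equation of (iii).

    [mu] has bounded support because [A^-k] decays geometrically. Therefore
    [e_z] makes sense in [L^2(mu)] for complex [z], and its first-order Taylor
    expansion, inserted in the bounded sesquilinear form obtained from [P_n] by
    polarization, shows that [h] is entire. By (iii), [h = 1].

    Finally [|v|^2 - lim P_n v] is a nonnegative quadratic form, bounded by
    [|v|^2] and vanishing on every [e_t], hence on the closed span of the
    exponentials, which is [L^2(mu)]. *)

Set Implicit Arguments. Unset Strict Implicit. Unset Printing Implicit Defensive.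

(** * Powers of the inverse of an expansive matrix *)

(** The proof works with quadratic quantities of functions defined at every point; no quotient by
    null functions is formed. The limit form is first known on its diagonal, where monotone
    convergence applies. Polarization turns this into convergence of the sesquilinear sums, and
    estimates uniform in [n] then pass to the limit.

    The delicate point is holomorphy: the square of [|<e_z, f_w>|] is not holomorphic in [z]. The
    form is therefore evaluated at [e_z] and at [e] of the conjugate of [z], so that the two
    conjugations cancel; on real frequencies this is still the diagonal. As [e_z] is unbounded for
    nonreal [z], it is multiplied by the indicator of a ball of full measure, and all remainder
    estimates become pointwise bounds.

    Density uses exponentials of arbitrarily low real frequency. The sign of a sine is a bounded
    pointwise limit of polynomials in it, and slow sines have eventually the sign of [x_i - a]; this
    yields half spaces, then Borel sets, then simple functions. *)

Lemma normC_Re (R : realType) (z : complex R) : `|z| = ((complex.Re `|z|)%:C)%C.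
Proof. by rewrite normc_def. Qed.

Lemma normC_real (R : realType) (x : R) : `|(x%:C)%C| = ((`|x|)%:C)%C :> complex R.
Proof. by rewrite normc_def /= expr0n /= addr0 sqrtr_sqr. Qed.

(** The constant [D] satisfies [K <= D * (s - |z|)], so that [|z| D s^k + K s^k <= D s^(k+1)].
    Taking [s] strictly above [|z|] absorbs the polynomial factor that appears when [r] equals
    [|z|]. *)
Lemma recurrence_geometric (R : realType) (z : complex R) (u w : nat -> complex R)
    (K r s : R) : 0 <= K -> 0 <= r -> complex.Re `|z| < s -> r <= s ->
  (forall k, u k.+1 = z * u k + w k) ->
  (forall k, `|w k| <= ((K * r ^+ k)%:C)%C) ->
  forall k, `|u k| <= (((complex.Re `|u 0%N| + K / (s - complex.Re `|z|)) * s ^+ k)%:C)%C.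
Proof.
move=> K0 r0 zs rs hu hw.
have s0 : 0 <= s by apply: le_trans rs.
have dz : 0 < s - complex.Re `|z| by rewrite subr_gt0.
set a := complex.Re `|z| in zs dz *.
have a0 : 0 <= a by rewrite /a normc_def /= sqrtr_ge0.
set D := _ + _.
have D0 : 0 <= complex.Re `|u 0%N| by rewrite normc_def /= sqrtr_ge0.
elim => [|k IH].
  rewrite expr0 mulr1 {1}normC_Re lecR /D lerDl.
  by rewrite divr_ge0 // ltW.
rewrite hu; apply: le_trans (ler_normD _ _) _.
rewrite normrM normC_Re -/a.
apply: (@le_trans _ _ ((a%:C)%C * ((D * s ^+ k)%:C)%C + ((K * r ^+ k)%:C)%C)).
  by apply: lerD (hw k); apply: ler_wpM2l IH; rewrite ler0c.
rewrite -rmorphM -rmorphD /= lecR exprS.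
have : K * r ^+ k <= K * s ^+ k by apply: ler_wpM2l => //; apply: lerXn2r.
have : K <= D * (s - a).
  rewrite /D mulrDl divfK ?gt_eqF // lerDr mulr_ge0 // ltW //.
have sk : 0 <= s ^+ k by rewrite exprn_ge0.
move=> /(ler_wpM2r sk) h1 h2; nra.
Qed.

(** Peeling off one root [z] turns each entry of [M ^+ k * v] into a scalar recurrence whose
    inhomogeneity, an entry of [M ^+ k * ((M - z%:M) * v)], decays by induction. Repeated roots need
    no separate care, so this stands in for the Jordan form. *)
Lemma annihilated_powers_decay (R : realType) (n : nat) (M : 'M[complex R]_n.+1)
    (rs : seq (complex R)) (v : 'M[complex R]_n.+1) :
  (forall z, z \in rs -> `|z| < 1) ->
  (\prod_(z <- rs) (M - z%:M)) * v = 0 ->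
  exists K r : R, [/\ 0 <= K, 0 <= r, r < 1 &
    forall k i j, `|(M ^+ k * v) i j| <= ((K * r ^+ k)%:C)%C].
Proof.
elim/last_ind: rs v => [|rs z IH] v hrs.
  rewrite big_nil mul1r => ->; exists 0, 0; split => // k i j.
  by rewrite mulr0 mxE normr0 mul0r.
rewrite big_rcons /= -mulrA => h.
have [||K [r [K0 r0 r1 hK]]] := IH ((M - z%:M) * v).
- by move=> y yrs; apply: hrs; rewrite mem_rcons inE yrs orbT.
- exact: h.
have z1 : complex.Re `|z| < 1.
  have := hrs z; rewrite mem_rcons inE eqxx => /(_ isT).
  by rewrite normC_Re -[1]/((1%:C)%C) ltcR.
have z0 : 0 <= complex.Re `|z| by rewrite normc_def /= sqrtr_ge0.
(* Halfway between the larger of the two rates and 1: above [|z|] for the recurrence, below 1 for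
   the decay. *)
pose s := (Num.max r (complex.Re `|z|) + 1) / 2.
have m1 : Num.max r (complex.Re `|z|) < 1 by rewrite gt_max r1.
have ms : Num.max r (complex.Re `|z|) < s by rewrite /s; lra.
have [rm zm] : r <= Num.max r (complex.Re `|z|) /\
   complex.Re `|z| <= Num.max r (complex.Re `|z|) by rewrite !le_max !lexx orbT.
have zs : complex.Re `|z| < s by lra.
have s0 : 0 <= s by lra.
have D0 : 0 <= K / (s - complex.Re `|z|) by apply: divr_ge0 => //; lra.
have hbd i j : exists2 c : R, 0 <= c & forall k, `|(M ^+ k * v) i j| <= ((c * s ^+ k)%:C)%C.
  exists (complex.Re `|(M ^+ 0 * v) i j| + K / (s - complex.Re `|z|)).
    by rewrite addr_ge0 // normc_def /= sqrtr_ge0.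
  apply: (@recurrence_geometric _ z (fun k => (M ^+ k * v) i j)
     (fun k => (M ^+ k * ((M - z%:M) * v)) i j) K r s) => //; first lra.
  move=> k; have -> : M ^+ k.+1 * v = z *: (M ^+ k * v) + M ^+ k * ((M - z%:M) * v).
    rewrite exprSr mulrBl mulrBr -mulrA.
    have -> : z%:M * v = z *: v :> 'M[complex R]_n.+1 by exact: mul_scalar_mx.
    by rewrite -scalerAr addrC subrK.
  by rewrite mxE [X in X + _]mxE.
have /choice [c hc] : forall p : 'I_n.+1 * 'I_n.+1, exists c : R, 0 <= c /\
    forall k, `|(M ^+ k * v) p.1 p.2| <= ((c * s ^+ k)%:C)%C.
  by move=> [i j]; have [c] := hbd i j; exists c.
exists (\sum_p c p), s; split => //; first by apply: sumr_ge0 => p _; case: (hc p).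
  by rewrite /s; lra.
move=> k i j; have [_ /(_ k)/= h2] := hc (i, j).
apply: le_trans h2 _; rewrite lecR ler_wpM2r ?exprn_ge0 //.
rewrite (bigD1 (i, j)) //= lerDl sumr_ge0 // => p _; by case: (hc p).
Qed.

Lemma expansive_unitmx (R : realType) (d : nat) (A : 'M[int]_d) :
  expansive R A -> imat R A \in unitmx.
Proof.
move=> hA; rewrite unitmxE unitfE; apply/negP => /det0P [v v0 hv].
have := hA 0; rewrite normr0 => h.
suff /h : eigenvalue (map_mx (fun k : int => k%:~R : complex R) A) 0 by rewrite ltr10.
apply/eigenvalueP; exists (map_mx (fun x : R => (x%:C)%C) v); last first.
  by rewrite map_mx_eq0.
rewrite scale0r -(map_mx0 (real_complex R)) -hv map_mxM; congr (_ *m _).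
by apply/matrixP => i j; rewrite !mxE rmorph_int.
Qed.

(** By Cayley-Hamilton the inverse is annihilated by the product over the roots of its
    characteristic polynomial, and these roots are inverses of eigenvalues of [A]. *)
Lemma expansive_inv_decay (R : realType) (d : nat) (A : 'M[int]_d) :
  expansive R A -> exists K r : R, [/\ 0 <= K, 0 <= r, r < 1 &
    forall k i j, `|(invmx (imat R A) ^+ k) i j| <= K * r ^+ k].
Proof.
case: d A => [|n] A hA.
  by exists 0, 0; split => // k [].
have uA := expansive_unitmx hA.
pose M : 'M[complex R]_n.+1 := map_mx (real_complex R) (invmx (imat R A)).
have [rs /=] := closed_field_poly_normal (char_poly M).
rewrite (monicP (char_poly_monic M)) scale1r => hrs.
have [||K [r [K0 r0 r1 hK]]] := @annihilated_powers_decay R n M rs 1.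
- move=> z zrs.
  have /eigenvalueP [v hv v0] : eigenvalue M z.
    by rewrite eigenvalue_root_char hrs root_prod_XsubC.
  have MA : M *m map_mx (real_complex R) (imat R A) = 1%:M.
    by rewrite -map_mxM mulVmx // map_mx1.
  have vE : v = z *: (v *m map_mx (real_complex R) (imat R A)).
    by rewrite -[LHS]mulmx1 -MA mulmxA hv scalemxAl.
  have z0 : z != 0 by apply: contra_neq v0 => z0; rewrite vE z0 scale0r.
  have := hA z^-1; rewrite normfV => h.
  rewrite -invf_gt1 ?normr_gt0 //; apply: h.
  apply/eigenvalueP; exists v => //.
  have -> : map_mx (fun k : int => k%:~R : complex R) A = map_mx (real_complex R) (imat R A).
    by apply/matrixP => i j; rewrite !mxE rmorph_int.
  by rewrite [X in _ = _ *: X]vE scalerA mulVf // scale1r.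
- rewrite mulr1 -(Cayley_Hamilton M) hrs rmorph_prod /=.
  by apply: eq_bigr => z _; rewrite rmorphB /= horner_mx_X horner_mx_C.
exists K, r; split => // k i j; rewrite -lecR -normC_real.
have := hK k i j; rewrite mulr1.
by rewrite -(rmorphXn (map_mx (real_complex R))) /= mxE.
Qed.

(** * Borel sets of R^d *)

(** Rational centres and radii [1 / (n + 1)] give a base of the topology indexed by a countable
    type, which [borel_ind] enumerates by [unpickle]. *)
Definition box (R : realType) (d : nat) (q : 'cV[rat]_d) (n : nat) : set 'cV[R]_d :=
  [set x | forall i, `|x i 0 - ratr (q i 0)| < n.+1%:R^-1].

Lemma sigma_algebraI (T : Type) (F : set (set T)) (E G : set T) :
  sigma_algebra setT F -> F E -> F G -> F (E `&` G).
Proof.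
move=> [F0 FC FU] FE FG.
have FCC H : F H -> F (~` H) by move/FC; rewrite setTD.
have FUU : F (~` E `|` ~` G).
  have -> : ~` E `|` ~` G = \bigcup_n (if n == 0%N then ~` E else ~` G).
    apply/seteqP; split => [x [Ex|Gx]|x [[|n] _ /=]];
      [by exists 0%N|by exists 1%N|by left|by right].
  by apply: FU => n; case: ifP => _; apply: FCC.
by have := FCC _ FUU; rewrite setCU !setCK.
Qed.

Lemma open_bigcup_box (R : realType) (d : nat) (O : set 'cV[R]_d) : open O ->
  O = \bigcup_(p in [set p : 'cV[rat]_d * nat | box (R := R) p.1 p.2 `<=` O]) box (R := R) p.1
    p.2.
Proof.
move=> oO; apply/seteqP; split => [x Ox|x [p pO px]]; last exact: pO.
have /nbhs_ballP [e /= e0 xO] := open_nbhs_nbhs (conj oO Ox).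
(* Both [x] and [y] will be within [1 / (n + 1)] of the centre in each coordinate, whence
   [e / 2]. *)
have [n hn] : exists n, n.+1%:R^-1 < e / 2.
  have e2 : 0 < e / 2 by rewrite divr_gt0.
  by have [n _ /(_ n (leqnn _)) hn] := near_infty_natSinv_lt (PosNum e2); exists n.
have n0 : 0 < n.+1%:R^-1 :> R by rewrite invr_gt0.
have /choice [q hq] : forall i, exists q : rat, `|x i 0 - ratr q| < n.+1%:R^-1.
  move=> i; have [q] := @rat_in_itvoo R (x i 0 - n.+1%:R^-1) (x i 0) (ltac:(by rewrite ltrBlDr
    ltrDl)).
  by rewrite in_itv/= => /andP[h1 h2]; exists q; rewrite ltr_norml; apply/andP; split;
    move: h1 h2 n0; set u := ratr _; set w := _^-1; lra.
exists ((\col_i q i), n) => /=; last by move=> i; rewrite mxE.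
move=> y hy; apply: xO; split => // i j; rewrite ord1 /ball /=.
have := hy i; have := hq i; rewrite mxE => h1 h2.
rewrite -(subrK (ratr (q i)) (x i 0)) -addrA.
apply: le_lt_trans (ler_normD _ _) _.
by rewrite [X in _ + X]distrC; move: h1 h2 hn; set w := n.+1%:R^-1; lra.
Qed.

(** A rational box is a finite intersection of open half spaces, and an open set is a countable
    union of rational boxes. This serves for the measurability of [tau] and for the indicators in
    the density argument. *)
Lemma borel_ind (R : realType) (d : nat) (F : set (set 'cV[R]_d)) :
  sigma_algebra setT F -> (forall i a, F [set x : 'cV[R]_d | a < x i 0]) ->
  forall E : set (Rd R d), measurable E -> F E.
Proof.
move=> sF hF; have [F0 FC FU] := sF.
have FCC H : F H -> F (~` H) by move/FC; rewrite setTD.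
have hF' i a : F [set x : 'cV[R]_d | x i 0 < a].
  rewrite (_ : [set x | _] = \bigcup_n ~` [set x : 'cV[R]_d | a - n.+1%:R^-1 < x i 0]);
    last first.
    apply/seteqP; split => [x /= xa|x [n _ /= /negP]]; last first.
      rewrite -leNgt => h; apply: le_lt_trans h _.
      by rewrite ltrBlDr ltrDl invr_gt0.
    have xa0 : 0 < a - x i 0 by rewrite subr_gt0.
    have [n _ /(_ n (leqnn _)) hn] := near_infty_natSinv_lt (PosNum xa0).
    by exists n => //=; apply/negP; rewrite -leNgt; move: hn => /=; set w := n.+1%:R^-1; lra.
  by apply: FU => n; apply: FCC.
have Fbox q n : F (box (R := R) q n).
  have H (s : seq 'I_d) :
      F [set x : 'cV[R]_d | forall i, i \in s -> `|x i 0 - ratr (q i 0)| < n.+1%:R^-1].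
    elim: s => [|i s IH].
      have -> : [set x : 'cV[R]_d | forall i, i \in [::] -> `|x i 0 - ratr (q i 0)| <
        n.+1%:R^-1] = ~` set0.
        by apply/seteqP; split => x //= _ i; rewrite ?in_nil.
      exact: FCC.
    have -> : [set x : 'cV[R]_d | forall j, j \in i :: s -> `|x j 0 - ratr (q j 0)| <
      n.+1%:R^-1] =
       ([set x : 'cV[R]_d | ratr (q i 0) - n.+1%:R^-1 < x i 0] `&`
        [set x : 'cV[R]_d | x i 0 < ratr (q i 0) + n.+1%:R^-1]) `&`
       [set x : 'cV[R]_d | forall i, i \in s -> `|x i 0 - ratr (q i 0)| < n.+1%:R^-1].
      apply/seteqP; split => [x /= h|x /= [[h1 h2] h3] j].
        split; last by move=> j js; apply: h; rewrite inE js orbT.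
        have := h i; rewrite inE eqxx => /(_ isT); rewrite ltr_norml => /andP[];
          set w := n.+1%:R^-1; set u := ratr _; split; lra.
      rewrite inE => /predU1P[->|/h3//]; rewrite ltr_norml; move: h1 h2; set w := n.+1%:R^-1;
        set u := ratr _ => *; apply/andP; split; lra.
    by apply: sigma_algebraI => //; apply: sigma_algebraI.
  have := H (enum 'I_d); congr (F _); apply/seteqP; split => x /= h i; last by move=> _; apply: h.
  by apply: h; rewrite mem_enum.
apply: smallest_sub => // O oO.
rewrite (open_bigcup_box oO).
set P := [set p | _].
have -> : \bigcup_(p in P) box (R := R) p.1 p.2 =
  \bigcup_n (if @unpickle ('cV[rat]_d * nat)%type n is Some p then
      (if `[< P p >] then box (R := R) p.1 p.2 else set0) else set0).
  apply/seteqP; split => [x [p Pp px]|x [n _]].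
    by exists (pickle p) => //; rewrite pickleK asboolT.
  by case: unpickle => // p; case: ifPn => // /asboolP Pp px; exists p.
by apply: FU => n; case: unpickle => // p; case: ifP.
Qed.

Lemma sigma_algebra_preimage (d1 d2 : measure_display) (T : measurableType d1)
    (U : Type) (f : T -> U) : sigma_algebra setT [set E | measurable (f @^-1` E)].
Proof.
split => /=; first by rewrite preimage_set0.
  by move=> E mE; rewrite setTD preimage_setC; apply: measurableC.
by move=> E mE; rewrite preimage_bigcup; apply: bigcup_measurable => n _.
Qed.

Section borel.
Variables (R : realType) (d : nat).

Lemma measurable_coord (i : 'I_d) : measurable_fun [set: Rd R d] (fun x : Rd R d => x i 0).
Proof.
apply: (measurability _ (RGenOInfty.measurableE R)) => _ [_ [a ->] <-].
rewrite setTI; apply: sub_sigma_algebra.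
have -> : (fun x : 'cV[R]_d => x i 0) @^-1` `]a, +oo[%classic = (fun x : 'cV[R]_d => x i 0)
  @^-1` [set y | y > a].
  by apply/seteqP; split => x /=; rewrite in_itv /= andbT.
apply: open_comp; last exact: open_gt.
move=> x _; exact: coord_continuous.
Qed.

Lemma measurable_dot (t : 'cV[R]_d) : measurable_fun [set: Rd R d] (fun x : Rd R d => dot t x).
Proof.
rewrite /dot; apply: measurable_sum => i; apply: measurable_funM => //.
exact: measurable_coord.
Qed.

Lemma tau_coord (A : 'M[int]_d) (b : 'cV[int]_d) (x : 'cV[R]_d) i :
  tau A b x i 0 = dot (row i (invmx (imat R A)))^T x + (invmx (imat R A) *m ivec R b) i 0.
Proof.
rewrite /tau mulmxDr mxE; congr (_ + _); rewrite mxE /dot.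
by apply: eq_bigr => j _; rewrite !mxE.
Qed.

Lemma measurable_tau (A : 'M[int]_d) (b : 'cV[int]_d) :
  measurable_fun [set: Rd R d] (tau (R := R) A b : Rd R d -> Rd R d).
Proof.
move=> _ E mE; rewrite setTI.
apply: (borel_ind (F := [set E | measurable ((tau (R := R) A b : Rd R d -> _) @^-1` E)])) mE.
  exact: sigma_algebra_preimage.
move=> i a /=.
have := (measurable_dot (row i (invmx (imat R A)))^T) measurableT `]a - (invmx (imat R A) *m
  ivec R b) i 0, +oo[%classic (measurable_itv _).
rewrite setTI; congr (measurable _); apply/seteqP.
by split => x /=; rewrite in_itv /= andbT tau_coord ltrBlDr.
Qed.
End borel.

(** * Integration against the self-affine measure *)

Section l1norm.
Variables (R : realType) (d : nat).

(** The sum norm is a finite sum of measurable functions, and it pairs with the largest coordinate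
    of a frequency to bound the exponent of an exponential. *)
Definition l1norm (x : 'cV[R]_d) : R := \sum_i `|x i 0|.

Lemma l1norm_ge0 x : 0 <= l1norm x.
Proof. by apply: sumr_ge0. Qed.

Lemma ler_l1normD x y : l1norm (x + y) <= l1norm x + l1norm y.
Proof. by rewrite /l1norm -big_split /=; apply: ler_sum => i _; rewrite mxE ler_normD. Qed.

Lemma ler_l1norm_sum n (x : 'I_n -> 'cV[R]_d) : l1norm (\sum_i x i) <= \sum_i l1norm (x i).
Proof.
elim/big_ind2 : _ => [|a b u v|//]; first by rewrite /l1norm big1 // => i _; rewrite mxE normr0.
by move=> h1 h2; apply: le_trans (ler_l1normD _ _) _; apply: lerD.
Qed.

Lemma ler_l1norm_mulmx (M : 'M[R]_d) (c : R) x : (forall i j, `|M i j| <= c) ->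
  l1norm (M *m x) <= d%:R * c * l1norm x.
Proof.
move=> hM; rewrite /l1norm; apply: (@le_trans _ _ (\sum_(i < d) c * l1norm x)).
  apply: ler_sum => i _; rewrite mxE; apply: le_trans (ler_norm_sum _ _ _) _.
  by rewrite /l1norm mulr_sumr; apply: ler_sum => j _; rewrite normrM ler_wpM2r.
by rewrite sumr_const card_ord -mulrA mulr_natl.
Qed.

Lemma measurable_l1norm : measurable_fun [set: Rd R d] (l1norm : Rd R d -> R).
Proof.
apply: measurable_sum => i; apply: measurableT_comp => //.
exact: measurable_coord.
Qed.

Lemma measurable_l1norm_le (M : R) : measurable ([set x | l1norm x <= M] : set (Rd R d)).
Proof.
have := measurable_l1norm measurableT (measurable_itv `]-oo, M]).
by rewrite setTI.
Qed.

Lemma foldr_tau (A : 'M[int]_d) (bs : seq 'cV[int]_d) (x : 'cV[R]_d) :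
  foldr (tau A) x bs = invmx (imat R A) ^+ size bs *m x +
    \sum_(k < size bs) invmx (imat R A) ^+ k.+1 *m ivec R (nth 0 bs k).
Proof.
elim: bs => [|b bs IH] /=.
  by rewrite big_ord0 expr0 addr0; exact: (esym (mul1mx _)).
rewrite /tau IH big_ord_recl /= expr1 !mulmxDr mulmxA.
rewrite -addrA; congr (_ + _); first by rewrite exprS.
rewrite addrC; congr (_ + _); rewrite mulmx_sumr; apply: eq_bigr => k _.
by rewrite mulmxA [in RHS]exprS.
Qed.

Lemma sum_geometric_le (r : R) n : 0 <= r -> r < 1 -> \sum_(k < n) r ^+ k.+1 <= (1 - r)^-1.
Proof.
move=> r0 r1; have r1' : 0 < 1 - r by rewrite subr_gt0.
have key : (\sum_(k < n) r ^+ k.+1) * (1 - r) = r - r ^+ n.+1.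
  elim: n => [|n IH]; first by rewrite big_ord0 expr1 subrr mul0r.
  by rewrite big_ord_recr /= mulrDl IH exprS [in RHS]exprS exprS; ring.
rewrite -(ler_pM2r r1') mulVf ?gt_eqF // key.
by apply: (@le_trans _ _ r); [rewrite lerBlDr lerDl exprn_ge0|exact: ltW].
Qed.

(** [C] is chosen before [M]: in [foldr_tau] the starting point is multiplied by a power of the
    inverse, and [n] is taken so large that this contributes at most 1; the remaining sum is
    dominated by a geometric series, independently of [n]. *)
Lemma foldr_tau_bounded (A : 'M[int]_d) (B : seq 'cV[int]_d) : expansive R A ->
  exists C : R, forall M : R, exists n, forall bs x, size bs = n -> all (mem B) bs ->
     l1norm x <= M -> l1norm (foldr (tau A) x bs) <= C.
Proof.
move=> /expansive_inv_decay [K [r [K0 r0 r1 hK]]].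
pose b := \sum_(v <- B) l1norm (ivec R v).
have b0 : 0 <= b by apply: sumr_ge0 => *; exact: l1norm_ge0.
have hb v : v \in B -> l1norm (ivec R v) <= b.
  rewrite /b; elim: (B) => [//|u s IH]; rewrite inE big_cons => /predU1P[->|/IH h].
    by rewrite lerDl sumr_ge0 // => *; exact: l1norm_ge0.
  by apply: le_trans h _; rewrite lerDr l1norm_ge0.
exists (1 + d%:R * K * b * (1 - r)^-1) => M.
have [n hn] : exists n, d%:R * K * `|M| * r ^+ n < 1.
  have r1' : `|r| < 1 by rewrite ger0_norm.
  have /cvgrPdist_lt/(_ 1 ltr01) [n _ /(_ n (leqnn n))] := cvg_geometric (d%:R * K * `|M|) r1'.
  rewrite /= sub0r normrN => h; exists n; apply: le_lt_trans h.
  exact: ler_norm.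
exists n => bs x sbs bsB xM; rewrite foldr_tau sbs.
apply: le_trans (ler_l1normD _ _) _; apply: lerD.
  apply: le_trans (ler_l1norm_mulmx _ (hK n)) _; apply: le_trans (ltW hn).
  rewrite -!mulrA ler_wpM2l // ler_wpM2l // mulrC ler_wpM2r ?exprn_ge0 //.
  exact: le_trans (ler_norm _).
apply: le_trans (ler_l1norm_sum _) _.
apply: (@le_trans _ _ (\sum_(k < n) (d%:R * K * b) * r ^+ k.+1)).
  apply: ler_sum => k _; apply: le_trans (ler_l1norm_mulmx _ (hK k.+1)) _.
  rewrite -!mulrA ler_wpM2l // ler_wpM2l // mulrC ler_wpM2r ?exprn_ge0 //.
  by apply: hb; move/allP: bsB; apply; rewrite mem_nth // sbs.
rewrite -mulr_sumr; apply: ler_wpM2l; last exact: sum_geometric_le.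
by rewrite !mulr_ge0.
Qed.
End l1norm.

Section invariant_measure.
Variables (R : realType) (d : nat) (A : 'M[int]_d) (B : seq 'cV[int]_d).
Variable (mu : probability (Rd R d) R).
Hypothesis B0 : B != [::].
Hypothesis mu_inv : forall E : set (Rd R d), measurable E ->
  mu E = ((((size B)%:R)^-1)%:E * \sum_(b <- B) mu (tau (R:=R) A b @^-1` E))%E.

(** Iterating the invariance [n] times makes [mu E] the mean of the measures of the preimages of [E]
    under the [n]-fold branches, and each of these preimages contains [F]. *)
Lemma invariant_foldr_le (n : nat) (E F : set (Rd R d)) : measurable E -> measurable F ->
  (forall bs x, size bs = n -> all (mem B) bs -> F x -> E (foldr (tau A) x bs)) ->
  (mu F <= mu E)%E.
Proof.
elim: n E => [|n IH] E mE mF h.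
  by apply: le_measure; rewrite ?inE // => x Fx; exact: (h [::] x).
rewrite (mu_inv mE).
apply: (@le_trans _ _ ((((size B)%:R)^-1)%:E * \sum_(b <- B) mu F)%E); last first.
  apply: lee_wpmul2l; first by rewrite lee_fin invr_ge0.
  rewrite big_seq [leRHS]big_seq; apply: lee_sum => b bB; apply: IH => //.
    by rewrite -[X in measurable X]setTI; apply: measurable_tau.
  by move=> bs x sbs bsB Fx; apply: (h (b :: bs)); rewrite //= ?sbs // bsB andbT.
rewrite -(fineK (fin_num_measure mu F mF)) sumEFin -EFinM lee_fin.
by rewrite big_const_seq count_predT iter_addr_0 -[X in _ * X]mulr_natl mulKf // pnatr_eq0
  size_eq0.
Qed.

(** The balls [F n] exhaust the space, so their measures tend to 1. Long compositions of branches
    send each of them into the ball of radius [C], whose measure is therefore at least that of every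
    [F n]. *)
Lemma invariant_bounded_support : expansive R A ->
  exists M : R, mu [set x | l1norm x <= M] = 1%E.
Proof.
move=> /(foldr_tau_bounded B) [C hC]; exists C.
pose F n : set (Rd R d) := [set x | l1norm x <= n%:R].
have mF n : measurable (F n) by exact: measurable_l1norm_le.
have FT : \bigcup_n F n = setT.
  apply/seteqP; split => // x _; exists (Num.bound (l1norm x)) => //=.
  by rewrite /F /= ltW // archi_boundP // l1norm_ge0.
have Fcvg : mu (F n) @[n --> \oo] --> mu setT.
  rewrite -FT; apply: nondecreasing_cvg_mu => //.
    by rewrite FT.
  move=> m n mn; apply/subsetPset => x /= h; apply: le_trans h _.
  by rewrite ler_nat.
apply/eqP; rewrite eq_le probability_le1 /=; last exact: measurable_l1norm_le.
rewrite -(probability_setT mu); apply: (cvge_to_le Fcvg).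
apply: nearW => n.
have [m hm] := hC n%:R.
apply: (@invariant_foldr_le m _ _ (measurable_l1norm_le _) (mF n)).
by move=> bs x sbs bsB Fx; apply: hm.
Qed.

(** Invariance identifies [mu] with a scaled finite sum of push-forwards by the branches, against
    which integrals are computed by change of variables. *)
Lemma ge0_integral_invariant (f : Rd R d -> \bar R) : measurable_fun setT f ->
  (forall x, 0 <= f x)%E ->
  (\int[mu]_x f x = (((size B)%:R)^-1)%:E * \sum_(b <- B) \int[mu]_x f (tau A b x))%E.
Proof.
move=> mf f0.
pose m_ (i : nat) := measure_function_pushforward__canonical__measure_function_Measure
  mu (measurable_tau A (nth 0 B i)).

have k0 : 0 <= ((size B)%:R)^-1 :> R by rewrite invr_ge0.
rewrite (eq_measure_integral (mscale (NngNum k0) (msum m_ (size B)))); last first.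
  move=> E mE _; transitivity ((((size B)%:R)^-1)%:E * \sum_(b <- B) mu (tau (R:=R) A b @^-1`
    E))%E; first exact: mu_inv.
  rewrite /mscale /= /msum /=; congr (_ * _)%E.
  by rewrite (big_nth 0) big_mkord.
rewrite ge0_integral_mscale //=; congr (_ * _)%E.
rewrite ge0_integral_measure_sum // (big_nth 0) big_mkord; apply: eq_bigr => i _.
by rewrite ge0_integral_pushforward //; exact: measurable_tau.
Qed.

Lemma integrable_invariant (g : Rd R d -> R) b : b \in B ->
  mu.-integrable setT (EFin \o g) -> mu.-integrable setT (EFin \o (g \o tau A b)).
Proof.
move=> bB /integrableP [mg ig]; apply/integrableP; split.
  apply/measurable_EFinP; apply: measurableT_comp; last exact: measurable_tau.
  exact/measurable_EFinP.
have mag : measurable_fun setT (abse \o (EFin \o g)) by exact: measurableT_comp.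
move: ig; rewrite (ge0_integral_invariant mag); last by move=> x; exact: abse_ge0.
have N0 : 0 < (size B)%:R :> R by rewrite ltr0n lt0n size_eq0.
rewrite -lte_pdivlMl ?invr_gt0 // gt0_muley ?lte_fin ?invr_gt0 //.
apply: le_lt_trans; rewrite (perm_big _ (perm_to_rem bB)) big_cons leeDl // sume_ge0 // => c _.
by apply: integral_ge0 => x _; apply: abse_ge0.
Qed.

Lemma Rintegral_invariant (g : Rd R d -> R) : mu.-integrable setT (EFin \o g) ->
  Rintegral mu setT g = ((size B)%:R)^-1 * \sum_(b <- B) Rintegral mu setT (g \o tau A b).
Proof.
move=> ig; have [mg _] := integrableP _ _ _ ig.
rewrite /Rintegral integralE.
rewrite (ge0_integral_invariant (f := (EFin \o g)^\+)%E) //; last exact: measurable_funepos.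
rewrite (ge0_integral_invariant (f := (EFin \o g)^\-)%E) //; last exact: measurable_funeneg.
(* The positive and negative parts have finite integrals along every branch; naming these as reals
   lets the extended subtraction be carried out in [R]. *)
pose p b := fine (\int[mu]_x (EFin \o (g \o tau A b))^\+ x)%E.
pose n b := fine (\int[mu]_x (EFin \o (g \o tau A b))^\- x)%E.
have hp b : b \in B -> (\int[mu]_x ((EFin \o g)^\+ (tau A b x)) = (p b)%:E)%E.
  move=> bB; have h := integrable_pos_fin_num measurableT (integrable_invariant bB ig).
  by rewrite /p fineK //; apply: eq_integral => x _; rewrite !funeposE.
have hn b : b \in B -> (\int[mu]_x ((EFin \o g)^\- (tau A b x)) = (n b)%:E)%E.
  move=> bB; have h := integrable_neg_fin_num measurableT (integrable_invariant bB ig).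
  by rewrite /n fineK //; apply: eq_integral => x _; rewrite !funenegE.
rewrite big_seq (eq_bigr _ hp) -big_seq big_seq [X in (_ - _ * X)%E]big_seq (eq_bigr _ hn)
  -big_seq.
rewrite -big_seq !sumEFin -!EFinM -EFinB /= -mulrBr -sumrB big_seq [in RHS]big_seq.
congr (_ * _); apply: eq_bigr => b bB.
rewrite integralE fineB //.
  exact: integrable_pos_fin_num (integrable_invariant bB ig).
exact: integrable_neg_fin_num (integrable_invariant bB ig).
Qed.
End invariant_measure.

(** * Complex-valued square-integrable functions *)

Section complex_facts.
Variable R : realType.
Implicit Types z w : complex R.

Lemma cReD z w : complex.Re (z + w) = complex.Re z + complex.Re w.
Proof. by case: z; case: w. Qed.
Lemma cImD z w : complex.Im (z + w) = complex.Im z + complex.Im w.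
Proof. by case: z; case: w. Qed.
Lemma cReM z w : complex.Re (z * w) = complex.Re z * complex.Re w - complex.Im z * complex.Im w.
Proof. by case: z; case: w. Qed.
Lemma cImM z w : complex.Im (z * w) = complex.Re z * complex.Im w + complex.Im z * complex.Re w.
Proof. by case: z => a b; case: w. Qed.
Lemma cReZ (x : R) z : complex.Re ((x%:C)%C * z) = x * complex.Re z.
Proof. by rewrite cReM /= mul0r subr0. Qed.
Lemma cImZ (x : R) z : complex.Im ((x%:C)%C * z) = x * complex.Im z.
Proof. by rewrite cImM /= mul0r addr0. Qed.
Lemma cReJ z : complex.Re (Num.conj z) = complex.Re z.
Proof. by case: z. Qed.
Lemma cImJ z : complex.Im (Num.conj z) = - complex.Im z.
Proof. by case: z. Qed.
Lemma complex_eqP z w : complex.Re z = complex.Re w -> complex.Im z = complex.Im w -> z = w.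
Proof. by case: z => a b; case: w => c e /= -> ->. Qed.

Lemma cabs2_ge0 z : 0 <= cabs2 z.
Proof. by rewrite /cabs2 addr_ge0 // sqr_ge0. Qed.
Lemma cabs2M z w : cabs2 (z * w) = cabs2 z * cabs2 w.
Proof. by rewrite /cabs2 cReM cImM; ring. Qed.
Lemma cabs2J z : cabs2 (Num.conj z) = cabs2 z.
Proof. by rewrite /cabs2 cReJ cImJ sqrrN. Qed.
Lemma cabs2C z : ((cabs2 z)%:C)%C = z * Num.conj z.
Proof. by apply: complex_eqP; rewrite ?cReM ?cImM ?cReJ ?cImJ /= /cabs2; ring. Qed.
Lemma cabs2_norm z : ((cabs2 z)%:C)%C = `|z| ^+ 2.
Proof. by rewrite /cabs2 add_Re2_Im2. Qed.
Lemma cabs2D_le z w : cabs2 (z + w) <= 2 * cabs2 z + 2 * cabs2 w.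
Proof.
rewrite /cabs2 cReD cImD -subr_ge0.
suff -> : 2 * (complex.Re z ^+ 2 + complex.Im z ^+ 2) +
  2 * (complex.Re w ^+ 2 + complex.Im w ^+ 2) -
  ((complex.Re z + complex.Re w) ^+ 2 + (complex.Im z + complex.Im w) ^+ 2)
  = (complex.Re z - complex.Re w) ^+ 2 + (complex.Im z - complex.Im w) ^+ 2.
  by rewrite addr_ge0 // sqr_ge0.
by ring.
Qed.
Lemma cabs2_0 : cabs2 (0 : complex R) = 0.
Proof. by rewrite /cabs2 /= expr0n addr0. Qed.
Lemma cabs2_1 : cabs2 (1 : complex R) = 1.
Proof. by rewrite /cabs2 /= expr0n expr1n addr0. Qed.
Lemma cabs2_real (x : R) : cabs2 ((x%:C)%C) = x ^+ 2.
Proof. by rewrite /cabs2 /= expr0n addr0. Qed.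
Lemma cabs2_e2pi (t : R) : cabs2 (e2pi t) = 1.
Proof. by rewrite /cabs2 /e2pi /= cos2Dsin2. Qed.
(** With [Im_le_cabs2], this dominates the product of two [L2] functions by an integrable one; only
    finiteness matters, not the constant. *)
Lemma Re_le_cabs2 z w : `|complex.Re (z * w)| <= cabs2 z + cabs2 w.
Proof.
rewrite cReM /cabs2; case: z w => a b [c e] /=.
have := sqr_ge0 (a + c); have := sqr_ge0 (a - c); have := sqr_ge0 (b + e);
  have := sqr_ge0 (b - e).
by have := sqr_ge0 a; have := sqr_ge0 b; rewrite ler_norml !expr2 => *; apply/andP; split; nra.
Qed.
Lemma Im_le_cabs2 z w : `|complex.Im (z * w)| <= cabs2 z + cabs2 w.
Proof.
rewrite cImM /cabs2; case: z w => a b [c e] /=.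
have := sqr_ge0 (a + e); have := sqr_ge0 (a - e); have := sqr_ge0 (b + c);
  have := sqr_ge0 (b - c).
by have := sqr_ge0 a; have := sqr_ge0 b; rewrite ler_norml !expr2 => *; apply/andP; split; nra.
Qed.

Lemma e2piD (s t : R) : e2pi (s + t) = e2pi s * e2pi t.
Proof.
by apply: complex_eqP; rewrite ?cReM ?cImM /e2pi /= mulrDr ?cosD ?sinD //; ring.
Qed.
Lemma e2pi0 : e2pi (0 : R) = 1.
Proof. by rewrite /e2pi mulr0 cos0 sin0. Qed.
Lemma e2piN (t : R) : e2pi (- t) = Num.conj (e2pi t).
Proof. by apply: complex_eqP; rewrite ?cReJ ?cImJ /e2pi /= mulrN ?cosN ?sinN. Qed.
Lemma e2pi_int (k : int) : e2pi (k%:~R : R) = 1.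
Proof.
have nat n : e2pi (n%:R : R) = 1.
  elim: n => [|n IH]; first exact: e2pi0.
  rewrite -natr1 e2piD IH mul1r /e2pi mulr1 -[2 * pi]/(2%:R * pi) mulr_natl cos2pi.
  by rewrite -[pi *+ 2]add0r sinD2pi sin0.
case: k => n; first exact: nat.
by rewrite NegzE mulrNz e2piN nat conjC1.
Qed.
End complex_facts.

Section L2theory.
Variables (R : realType) (d : nat) (mu : probability (Rd R d) R).
Implicit Types f g u v : 'cV[R]_d -> complex R.

Definition cmeas f := measurable_fun [set: Rd R d] (fun x : Rd R d => complex.Re (f x)) /\
  measurable_fun [set: Rd R d] (fun x : Rd R d => complex.Im (f x)).
Definition cintegrable f := mu.-integrable setT (EFin \o (fun x : Rd R d => complex.Re (f x))) /\
  mu.-integrable setT (EFin \o (fun x : Rd R d => complex.Im (f x))).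

Lemma cmeasD f g : cmeas f -> cmeas g -> cmeas (fun x => f x + g x).
Proof.
move=> [f1 f2] [g1 g2]; split.
  by under eq_fun do rewrite cReD; exact: measurable_funD.
by under eq_fun do rewrite cImD; exact: measurable_funD.
Qed.

Lemma cmeasM f g : cmeas f -> cmeas g -> cmeas (fun x => f x * g x).
Proof.
move=> [f1 f2] [g1 g2]; split.
  by under eq_fun do rewrite cReM; apply: measurable_funB; exact: measurable_funM.
by under eq_fun do rewrite cImM; apply: measurable_funD; exact: measurable_funM.
Qed.

Lemma cmeasJ f : cmeas f -> cmeas (fun x => Num.conj (f x)).
Proof.
move=> [f1 f2]; split; first by under eq_fun do rewrite cReJ.
by under eq_fun do rewrite cImJ; exact: measurableT_comp.
Qed.

Lemma cmeas_cst (c : complex R) : cmeas (fun=> c).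
Proof. by split; exact: measurable_cst. Qed.

Lemma cmeas_sum (I : eqType) (s : seq I) (F : I -> 'cV[R]_d -> complex R) :
  (forall i, i \in s -> cmeas (F i)) -> cmeas (fun x => \sum_(i <- s) F i x).
Proof.
elim: s => [|i s IH] h.
  by under eq_fun do rewrite big_nil; exact: cmeas_cst.
under eq_fun do rewrite big_cons; apply: cmeasD; first by apply: h; rewrite inE eqxx.
by apply: IH => j js; apply: h; rewrite inE js orbT.
Qed.

Lemma cmeas_tau f (A : 'M[int]_d) b : cmeas f -> cmeas (fun x => f (tau A b x)).
Proof.
move=> [f1 f2]; split.
  by apply: (measurableT_comp f1); exact: measurable_tau.
by apply: (measurableT_comp f2); exact: measurable_tau.
Qed.

Lemma cmeas_real (f : Rd R d -> R) : measurable_fun setT f -> cmeas (fun x => ((f x)%:C)%C).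
Proof. by move=> mf; split => //=; exact: measurable_cst. Qed.

Lemma measurable_cabs2 f : cmeas f -> measurable_fun [set: Rd R d] (fun x : Rd R d => cabs2 (f
  x)).
Proof. by move=> [f1 f2]; apply: measurable_funD; exact: measurable_funX. Qed.

Lemma cmeas_e2pi (t : 'cV[R]_d) : cmeas (fun x => e2pi (dot t x)).
Proof.
have h : measurable_fun [set: Rd R d] (fun x : Rd R d => 2 * pi * dot t x).
  by apply: measurable_funM => //; exact: measurable_dot.
split => /=; apply: measurableT_comp h => //; apply: continuous_measurable_fun.
  exact: continuous_cos.
exact: continuous_sin.
Qed.

Lemma cintD f g : cintegrable f -> cintegrable g ->
  cint mu (fun x => f x + g x) = cint mu f + cint mu g.
Proof.
move=> [f1 f2] [g1 g2]; rewrite /cint; apply: complex_eqP => /=.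
  by under eq_Rintegral do rewrite cReD; exact: RintegralD.
by under eq_Rintegral do rewrite cImD; exact: RintegralD.
Qed.

Lemma integrableZl' (c : R) (f : Rd R d -> R) : mu.-integrable setT (EFin \o f) ->
  mu.-integrable setT (EFin \o (fun x => c * f x)).
Proof.
by move=> h; have := integrableZl measurableT c h; apply: eq_integrable.
Qed.

Lemma integrableD' (f g : Rd R d -> R) : mu.-integrable setT (EFin \o f) ->
  mu.-integrable setT (EFin \o g) -> mu.-integrable setT (EFin \o (fun x => f x + g x)).
Proof. by move=> h1 h2; have := integrableD measurableT h1 h2; apply: eq_integrable. Qed.

Lemma cintZ (c : complex R) f : cintegrable f -> cint mu (fun x => c * f x) = c * cint mu f.
Proof.
move=> [f1 f2]; rewrite /cint; apply: complex_eqP; rewrite ?cReM ?cImM /=.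
  under eq_Rintegral do rewrite cReM -mulNr.
  by rewrite RintegralD ?RintegralZl ?mulNr //; exact: integrableZl'.
under eq_Rintegral do rewrite cImM.
by rewrite RintegralD ?RintegralZl //; exact: integrableZl'.
Qed.

Lemma cint0 : cint mu (fun=> 0) = 0.
Proof. by rewrite /cint /= Rintegral_cst // mul0r. Qed.

Lemma cintegrable_dominated f (h : Rd R d -> R) : cmeas f -> mu.-integrable setT (EFin \o h) ->
  (forall x, `|complex.Re (f x)| <= h x) -> (forall x, `|complex.Im (f x)| <= h x) ->
  cintegrable f.
Proof.
move=> [f1 f2] ih h1 h2; split.
  apply: (le_integrable measurableT) ih; first exact/measurable_EFinP.
  by move=> x _ /=; rewrite lee_fin (le_trans (h1 x)) // ler_norm.
apply: (le_integrable measurableT) ih; first exact/measurable_EFinP.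
by move=> x _ /=; rewrite lee_fin (le_trans (h2 x)) // ler_norm.
Qed.

Lemma L2_cmeas f : L2 mu f -> cmeas f.
Proof. by move=> [f1 [f2 _]]. Qed.

Lemma L2_integrable_cabs2 f : L2 mu f -> mu.-integrable setT (EFin \o (fun x : Rd R d => cabs2
  (f x))).
Proof.
move=> hf; have [_ [_ h]] := hf; apply/integrableP; split.
  by apply/measurable_EFinP; apply: measurable_cabs2; exact: L2_cmeas.
move: h; congr (_ < _)%E; apply: eq_integral => x _ /=.
by rewrite ger0_norm // cabs2_ge0.
Qed.

Lemma L2_dominated f (h : Rd R d -> R) : cmeas f -> mu.-integrable setT (EFin \o h) ->
  (forall x, cabs2 (f x) <= h x) -> L2 mu f.
Proof.
move=> mf /integrableP [mh ih] fh; have [f1 f2] := mf; split => //; split => //.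
apply: le_lt_trans ih; apply: ge0_le_integral => //.
- by move=> x _; rewrite lee_fin cabs2_ge0.
- by apply/measurable_EFinP; exact: measurable_cabs2.
- by apply: measurableT_comp.
- by move=> x _ /=; rewrite lee_fin (le_trans (fh x)) // ler_norm.
Qed.

(* [probability_setT] with [mu] coerced to a measure, the form in which the
   integral lemmas mention it. *)
Lemma measure_setT1 : (mu : {measure set (Rd R d) -> \bar R}) [set: Rd R d] = 1%E.
Proof. exact: probability_setT. Qed.

Lemma integrable_cst (c : R) : mu.-integrable setT (EFin \o (fun _ : Rd R d => c)).
Proof.
apply/integrableP; split; first exact: measurable_cst.
by rewrite /= integral_cst // measure_setT1 mule1 ltry.
Qed.

Lemma L2_bounded f (M : R) : cmeas f -> (forall x, cabs2 (f x) <= M) -> L2 mu f.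
Proof. by move=> mf h; apply: (L2_dominated mf (integrable_cst M)). Qed.

Lemma L2D f g : L2 mu f -> L2 mu g -> L2 mu (fun x => f x + g x).
Proof.
move=> hf hg; apply: (L2_dominated (h := fun x => 2 * cabs2 (f x) + 2 * cabs2 (g x))).
- by apply: cmeasD; exact: L2_cmeas.
- by apply: integrableD'; apply: integrableZl'; exact: L2_integrable_cabs2.
- by move=> x; exact: cabs2D_le.
Qed.

Lemma L2Z (c : complex R) f : L2 mu f -> L2 mu (fun x => c * f x).
Proof.
move=> hf; apply: (L2_dominated (h := fun x => cabs2 c * cabs2 (f x))).
- by apply: cmeasM; [exact: cmeas_cst|exact: L2_cmeas].
- by apply: integrableZl'; exact: L2_integrable_cabs2.
- by move=> x; rewrite cabs2M.
Qed.

Lemma L2_mul_bounded f g (M : R) : L2 mu f -> cmeas g -> (forall x, cabs2 (g x) <= M) ->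
  L2 mu (fun x => f x * g x).
Proof.
move=> hf mg gM; apply: (L2_dominated (h := fun x => M * cabs2 (f x))).
- by apply: cmeasM => //; exact: L2_cmeas.
- by apply: integrableZl'; exact: L2_integrable_cabs2.
- by move=> x; rewrite cabs2M mulrC ler_wpM2r // cabs2_ge0.
Qed.

Lemma L2_sum (I : eqType) (s : seq I) (F : I -> 'cV[R]_d -> complex R) :
  (forall i, i \in s -> L2 mu (F i)) -> L2 mu (fun x => \sum_(i <- s) F i x).
Proof.
elim: s => [|i s IH] h.
  under eq_fun do rewrite big_nil; apply: (L2_bounded (M := 0)); first exact: cmeas_cst.
  by move=> x; rewrite cabs2_0.
under eq_fun do rewrite big_cons; apply: L2D; first by apply: h; rewrite inE eqxx.
by apply: IH => j js; apply: h; rewrite inE js orbT.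
Qed.

Lemma L2_e2pi (t : 'cV[R]_d) : L2 mu (fun x => e2pi (dot t x)).
Proof.
apply: (L2_bounded (M := 1)); first exact: cmeas_e2pi.
by move=> x; rewrite cabs2_e2pi.
Qed.

Lemma cintegrable_inner f g : L2 mu f -> L2 mu g -> cintegrable (fun x => f x * Num.conj (g x)).
Proof.
move=> hf hg; apply: (cintegrable_dominated (h := fun x => cabs2 (f x) + cabs2 (g x))).
- by apply: cmeasM; [exact: L2_cmeas|apply: cmeasJ; exact: L2_cmeas].
- by apply: integrableD'; exact: L2_integrable_cabs2.
- by move=> x; rewrite -(cabs2J (g x)); exact: Re_le_cabs2.
- by move=> x; rewrite -(cabs2J (g x)); exact: Im_le_cabs2.
Qed.

Lemma innerD u v f : L2 mu u -> L2 mu v -> L2 mu f ->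
  inner mu (fun x => u x + v x) f = inner mu u f + inner mu v f.
Proof.
move=> hu hv hf; rewrite /inner -cintD; [|exact: cintegrable_inner..].
by congr (cint mu _); apply/funext => x; rewrite mulrDl.
Qed.

Lemma innerZ (c : complex R) u f : L2 mu u -> L2 mu f ->
  inner mu (fun x => c * u x) f = c * inner mu u f.
Proof.
move=> hu hf; rewrite /inner -cintZ; last exact: cintegrable_inner.
by congr (cint mu _); apply/funext => x; rewrite mulrA.
Qed.

Definition nrm2 f : R := Rintegral mu setT (fun x => cabs2 (f x)).

Lemma nrm2E f : L2 mu f -> (\int[mu]_x (cabs2 (f x))%:E = (nrm2 f)%:E)%E.
Proof.
move=> hf; rewrite /nrm2 /Rintegral fineK //.
by have := integrable_fin_num measurableT (L2_integrable_cabs2 hf).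
Qed.

Lemma nrm2_ge0 f : 0 <= nrm2 f.
Proof. by apply: Rintegral_ge0 => x _; exact: cabs2_ge0. Qed.

Lemma nrm2Z (c : complex R) f : L2 mu f -> nrm2 (fun x => c * f x) = cabs2 c * nrm2 f.
Proof.
move=> hf; rewrite /nrm2; under eq_Rintegral do rewrite cabs2M.
by rewrite RintegralZl //; exact: L2_integrable_cabs2.
Qed.

Lemma nrm2_le_bounded f (M : R) : cmeas f -> (forall x, cabs2 (f x) <= M) -> nrm2 f <= M.
Proof.
move=> mf h; have -> : M = Rintegral mu setT (fun _ : Rd R d => M).
  by rewrite Rintegral_cst // measure_setT1 mulr1.
apply: le_Rintegral => //; first by apply: L2_integrable_cabs2; exact: L2_bounded h.
exact: integrable_cst.
Qed.

Lemma innerZr (c : complex R) u f : L2 mu u -> L2 mu f ->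
  inner mu u (fun x => c * f x) = Num.conj c * inner mu u f.
Proof.
move=> hu hf; rewrite /inner -cintZ; last exact: cintegrable_inner.
by congr (cint mu _); apply/funext => x; rewrite rmorphM mulrCA.
Qed.

Lemma nrm2D u v : L2 mu u -> L2 mu v ->
  nrm2 (fun x => u x + v x) = nrm2 u + nrm2 v + 2 * complex.Re (inner mu u v).
Proof.
move=> hu hv; have [h _] := cintegrable_inner hu hv.
rewrite /nrm2 /inner /cint /= -RintegralZl // -RintegralD //; [|exact: L2_integrable_cabs2..].
rewrite -RintegralD //; last 2 first.
- by apply: integrableD'; exact: L2_integrable_cabs2.
- exact: integrableZl'.
by apply: eq_Rintegral => x _; rewrite /cabs2 !cReD !cImD !cReM cReJ cImJ; ring.
Qed.

(** Expand [0 <= |v - <v, f> f|^2] with [|f| = 1]. This is the Bessel bound for the empty word,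
    whose frame element is 1. *)
Lemma inner_unimodular_le v f : L2 mu v -> cmeas f -> (forall x, cabs2 (f x) = 1) ->
  cabs2 (inner mu v f) <= nrm2 v.
Proof.
move=> hv mf f1; have hf : L2 mu f by apply: (L2_bounded (M := 1)) => // x; rewrite f1.
have nf : nrm2 f = 1.
  by rewrite /nrm2; under eq_Rintegral do rewrite f1;
    rewrite Rintegral_cst // measure_setT1 mulr1.
have := nrm2_ge0 (fun x => v x + (- inner mu v f) * f x).
rewrite nrm2D //; last exact: L2Z.
rewrite nrm2Z // innerZr // nf mulr1.
set c := inner mu v f.
by case: c => a b; rewrite /cabs2 /=; nra.
Qed.
End L2theory.

(** * The partial frame sums *)

Section dot.
Variables (R : realType) (d : nat).
Implicit Types x y : 'cV[R]_d.

Lemma dotC x y : dot x y = dot y x.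
Proof. by apply: eq_bigr => i _; rewrite mulrC. Qed.
Lemma dotDr x y z : dot x (y + z) = dot x y + dot x z.
Proof. by rewrite /dot -big_split /=; apply: eq_bigr => i _; rewrite mxE mulrDr. Qed.
Lemma dotDl x y z : dot (x + y) z = dot x z + dot y z.
Proof. by rewrite dotC dotDr !(dotC z). Qed.
Lemma dotNl x y : dot (- x) y = - dot x y.
Proof. by rewrite /dot -sumrN; apply: eq_bigr => i _; rewrite mxE mulNr. Qed.
Lemma dot0l x : dot 0 x = 0.
Proof. by rewrite /dot big1 // => i _; rewrite mxE mul0r. Qed.
Lemma dot_mulmx (M : 'M[R]_d) x y : dot (M^T *m x) y = dot x (M *m y).
Proof.
rewrite /dot; under eq_bigr do rewrite mxE mulr_suml.
rewrite exchange_big /=; apply: eq_bigr => i _; rewrite mxE mulr_sumr.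
by apply: eq_bigr => j _; rewrite !mxE mulrAC mulrC.
Qed.
Lemma dot_ivec (k l : 'cV[int]_d) : dot (ivec R k) (ivec R l) = (\sum_i k i 0 * l i 0)%:~R.
Proof. by rewrite rmorph_sum /=; apply: eq_bigr => i _; rewrite !mxE rmorphM. Qed.
End dot.

(* Over an abstract closed field because [complex R] carries several
   non-unifiable additive structures. *)
Lemma isometry_sum_mulJ (C : numClosedFieldType) m n (T : 'M[C]_(m, n)) (y : 'I_n -> C) :
  (map_mx Num.conj T)^T *m T = 1%:M ->
  \sum_i (\sum_j y j * Num.conj (T i j)) * Num.conj (\sum_j y j * Num.conj (T i j)) =
  \sum_j y j * Num.conj (y j).
Proof.
move=> hT; under eq_bigr do rewrite rmorph_sum mulr_suml /=.
rewrite exchange_big /=; apply: eq_bigr => j _.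
under eq_bigr do rewrite mulr_sumr /=.
rewrite exchange_big /=.
have hT' k : \sum_i Num.conj (T i j) * T i k = (j == k)%:R.
  have := congr1 (fun M : 'M[C]_n => M j k) hT; rewrite !mxE => <-.
  by apply: eq_bigr => i _; rewrite !mxE.
have hk k : \sum_i y j * Num.conj (T i j) * Num.conj (y k * Num.conj (T i k)) =
    y j * Num.conj (y k) * (j == k)%:R.
  rewrite -hT' mulr_sumr; apply: eq_bigr => i _; rewrite rmorphM /= conjCK; ring.
transitivity (\sum_k y j * Num.conj (y k) * (j == k)%:R); first by apply: eq_bigr => k _.
rewrite (bigD1 j) //= big1 ?addr0 => [|k kj]; first by rewrite eqxx mulr1.
by rewrite eq_sym (negPf kj) mulr0.
Qed.

Lemma isometry_sum_cabs2 (R : realType) m n (T : 'M[complex R]_(m, n)) (y : 'I_n -> complex R) :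
  (map_mx Num.conj T)^T *m T = 1%:M ->
  \sum_i cabs2 (\sum_j y j * Num.conj (T i j)) = \sum_j cabs2 (y j).
Proof.
move=> /(isometry_sum_mulJ y) h; apply: (@complexI R); rewrite !rmorph_sum /=.
under eq_bigr do rewrite cabs2C.
by under [RHS]eq_bigr do rewrite cabs2C.
Qed.

Section frame.
Variables (R : realType) (d : nat) (A : 'M[int]_d) (B : seq 'cV[int]_d).
Variables (mu : probability (Rd R d) R) (L : seq 'cV[int]_d).
Variable (alpha : 'cV[int]_d -> complex R).
Hypothesis uA : imat R A \in unitmx.
Hypothesis B0 : B != [::].
Hypothesis mu_inv : forall E : set (Rd R d), measurable E ->
  mu E = ((((size B)%:R)^-1)%:E * \sum_(b <- B) mu (tau (R:=R) A b @^-1` E))%E.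
Hypothesis L0 : 0 \in L.
Hypothesis alpha0 : alpha 0 = 1.
Hypothesis TT : (map_mx Num.conj (Tmat A B L alpha))^T *m Tmat A B L alpha = 1%:M.
Implicit Types u v : 'cV[R]_d -> complex R.

Notation fe := (frame_elt A alpha).
Notation N := (size B).

Lemma freq_nil : freq R A [::] = 0.
Proof. by rewrite /freq big_ord0. Qed.

Lemma freq_cons l w : freq R A (l :: w) = ivec R l + (imat R A)^T *m freq R A w.
Proof.
rewrite /freq big_ord_recl /= expr0; congr (_ + _); first exact: mul1mx.
rewrite mulmx_sumr; apply: eq_bigr => i _.
by rewrite exprS mulmxA.
Qed.

Lemma freq_integral w : exists k, freq R A w = ivec R k.
Proof.
elim: w => [|l w [k hk]].
  by exists 0; rewrite freq_nil; apply/matrixP => i j; rewrite !mxE.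
exists (l + A^T *m k); rewrite freq_cons hk /ivec /imat.
apply/matrixP => i j; rewrite !mxE rmorphD /= rmorph_sum; congr (_ + _).
by apply: eq_bigr => m _; rewrite !mxE rmorphM.
Qed.

(** Integrality of the data enters here: the translation by [b] inside [tau] does not affect the
    factor attached to [w]. *)
Lemma e2pi_freq_ivec w b : e2pi (dot (freq R A w) (ivec R b)) = 1.
Proof. by have [k ->] := freq_integral w; rewrite dot_ivec e2pi_int. Qed.

Lemma frame_elt_tau l w b x : fe (l :: w) (tau A b x) =
  alpha l * e2pi (dot (ivec R l) (tau A b x)) * fe w x.
Proof.
rewrite /frame_elt big_cons freq_cons dotDl e2piD dot_mulmx {2}/tau mulKVmx //.
by rewrite dotDr e2piD e2pi_freq_ivec; ring.
Qed.

Lemma frame_elt_nil x : fe [::] x = 1.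
Proof. by rewrite /frame_elt big_nil freq_nil dot0l e2pi0 mulr1. Qed.

Lemma L2_frame_elt w : L2 mu (fe w).
Proof. by apply: L2Z; exact: L2_e2pi. Qed.

Lemma cint_invariant g : cintegrable mu g ->
  cint mu g = ((N%:R)^-1) * \sum_(b <- B) cint mu (fun x => g (tau A b x)).
Proof.
move=> [g1 g2]; have NE : (N%:R^-1 : complex R) = (((N%:R : R)^-1)%:C)%C.
  by rewrite fmorphV /= rmorph_nat.
rewrite NE; apply: complex_eqP; rewrite ?cReZ ?cImZ [LHS]/=.
  rewrite (Rintegral_invariant B0 mu_inv g1); congr (_ * _).
  by elim: (B) => [|b s IH]; rewrite ?big_nil // !big_cons cReD -IH.
rewrite (Rintegral_invariant B0 mu_inv g2); congr (_ * _).
by elim: (B) => [|b s IH]; rewrite ?big_nil // !big_cons cImD -IH.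
Qed.

Lemma L2_tau v b : b \in B -> L2 mu v -> L2 mu (fun x => v (tau A b x)).
Proof.
move=> bB hv; apply: (L2_dominated (h := fun x => cabs2 (v (tau A b x)))) => //.
  by apply: (cmeas_tau (f := v)); exact: L2_cmeas hv.
exact: (integrable_invariant B0 mu_inv bB (L2_integrable_cabs2 hv)).
Qed.

(** Only the adjoint is used. It averages over the branches and makes sense at every point, whereas
    the operator itself would have to decide on which branch a point lies. *)
Definition Sadj (l : 'cV[int]_d) v : 'cV[R]_d -> complex R := fun x =>
  (N%:R)^-1 * \sum_(b <- B) v (tau A b x) * Num.conj (alpha l * e2pi (dot (ivec R l) (tau A b
    x))).

Lemma L2_Sadj_term l v b : b \in B -> L2 mu v -> L2 mu (fun x =>
  v (tau A b x) * Num.conj (alpha l * e2pi (dot (ivec R l) (tau A b x)))).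
Proof.
move=> bB hv; apply: (L2_mul_bounded (M := cabs2 (alpha l))); first exact: L2_tau.
  apply: cmeasJ; apply: cmeasM; first exact: cmeas_cst.
  by apply: (cmeas_tau (f := fun x => e2pi (dot (ivec R l) x))); exact: cmeas_e2pi.
by move=> x; rewrite cabs2J cabs2M cabs2_e2pi mulr1.
Qed.

Lemma L2_Sadj l v : L2 mu v -> L2 mu (Sadj l v).
Proof. by move=> hv; apply: L2Z; apply: L2_sum => b bB; exact: L2_Sadj_term. Qed.

Lemma inner_sum (I : eqType) (s : seq I) (F : I -> 'cV[R]_d -> complex R) f :
  (forall i, i \in s -> L2 mu (F i)) -> L2 mu f ->
  inner mu (fun x => \sum_(i <- s) F i x) f = \sum_(i <- s) inner mu (F i) f.
Proof.
elim: s => [|i s IH] h hf.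
  rewrite big_nil; under eq_fun do rewrite big_nil.
  by rewrite /inner -[RHS](cint0 mu); congr cint; apply/funext => x; rewrite mul0r.
under eq_fun do rewrite big_cons.
have hs j : j \in s -> L2 mu (F j) by move=> js; apply: h; rewrite inE js orbT.
rewrite innerD // ?IH ?big_cons //; first by apply: h; rewrite inE eqxx.
exact: L2_sum.
Qed.

Lemma inner_frame_cons l w v : L2 mu v -> inner mu v (fe (l :: w)) = inner mu (Sadj l v) (fe w).
Proof.
move=> hv; rewrite /Sadj innerZ; [|by apply: L2_sum => b bB;
  exact: L2_Sadj_term|exact: L2_frame_elt].
rewrite inner_sum; [|by move=> b bB; exact: L2_Sadj_term|exact: L2_frame_elt].
rewrite {1}/inner cint_invariant; last by apply: cintegrable_inner => //; exact: L2_frame_elt.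
congr (_ * _); apply: eq_bigr => b _; rewrite /inner; congr cint; apply/funext => x.
by rewrite frame_elt_tau rmorphM mulrA.
Qed.

(** At a fixed [x], up to a unimodular factor and [1 / sqrt N], the values [Sadj l v x] are the
    coordinates of the conjugate of [T] applied to the vector of the [v (tau A b x)], and an
    isometry preserves sums of squares. *)
Lemma sum_cabs2_Sadj v x :
  \sum_(l <- L) cabs2 (Sadj l v x) = (N%:R)^-1 * \sum_(b <- B) cabs2 (v (tau A b x)).
Proof.
have N0 : 0 < N%:R :> R by rewrite ltr0n lt0n size_eq0.
rewrite (big_nth 0) big_mkord [in RHS](big_nth 0) big_mkord.
rewrite -(isometry_sum_cabs2 (fun j => v (tau A (nth 0 B j) x)) TT) mulr_sumr.
apply: eq_bigr => i _; set l := nth 0 L i.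
have -> : Sadj l v x = (((Num.sqrt (N%:R : R))^-1)%:C)%C *
   Num.conj (e2pi (dot (invmx (imat R A)^T *m ivec R l) x)) *
   (\sum_(j < N) v (tau A (nth 0 B j) x) * Num.conj (Tmat A B L alpha i j)).
  rewrite /Sadj (big_nth 0) big_mkord !mulr_sumr; apply: eq_bigr => j _.
  rewrite mxE -/l /tau mulmxDr dotDr e2piD.
  have dE y : dot (ivec R l) (invmx (imat R A) *m y) = dot (invmx (imat R A)^T *m ivec R l) y.
    by rewrite -trmx_inv dot_mulmx.
  rewrite !dE !rmorphM /=.
  have -> : (N%:R^-1 : complex R) = (((Num.sqrt (N%:R : R))^-1)%:C)%C * (((Num.sqrt (N%:R :
    R))^-1)%:C)%C.
    by rewrite -rmorphM /= -invfM -expr2 sqr_sqrtr ?ltW // fmorphV /= rmorph_nat.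
  have -> : Num.conj (((Num.sqrt (N%:R : R))^-1)%:C)%C = (((Num.sqrt (N%:R : R))^-1)%:C)%C :>
    complex R.
    by apply: complex_eqP; rewrite ?cReJ ?cImJ /= ?oppr0.
  by ring.
rewrite !cabs2M cabs2J cabs2_e2pi mulr1 cabs2_real exprVn sqr_sqrtr ?ltW //.
Qed.

Lemma nrm2_Sadj v : L2 mu v -> \sum_(l <- L) nrm2 mu (Sadj l v) = nrm2 mu v.
Proof.
move=> hv; rewrite [RHS]/nrm2 (Rintegral_invariant B0 mu_inv (L2_integrable_cabs2 hv)).
(* Finite additivity of the integral together with integrability of the sum, applied once over [B]
   and once over [L]. *)
have hs (I : eqType) (s : seq I) (F : I -> Rd R d -> R) :
    (forall i, i \in s -> mu.-integrable setT (EFin \o F i)) ->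
    mu.-integrable setT (EFin \o (fun x => \sum_(i <- s) F i x)) /\
    \sum_(i <- s) Rintegral mu setT (F i) = Rintegral mu setT (fun x => \sum_(i <- s) F i x).
  elim: s => [|i s IH] h.
    rewrite big_nil; under eq_fun do rewrite big_nil; split; first exact: integrable_cst.
    by rewrite Rintegral_cst // mul0r.
  have [|h1 h2] := IH; first by move=> j js; apply: h; rewrite inE js orbT.
  under eq_fun do rewrite big_cons.
  have hi : mu.-integrable setT (EFin \o F i) by apply: h; rewrite inE eqxx.
  by split; [exact: integrableD'|rewrite big_cons h2 RintegralD].
have [|i1 ->] := hs _ B (fun b => (fun x => cabs2 (v x)) \o tau A b).
  by move=> b bB; exact: (integrable_invariant B0 mu_inv bB (L2_integrable_cabs2 hv)).
rewrite -RintegralZl //.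
have [|i2 ->] := hs _ L (fun l x => cabs2 (Sadj l v x)).
  by move=> l _; apply: L2_integrable_cabs2; exact: L2_Sadj.
by apply: eq_Rintegral => x _; rewrite sum_cabs2_Sadj.
Qed.

Fixpoint words (n : nat) : seq (seq 'cV[int]_d) :=
  if n is n'.+1 then [seq l :: w | l <- L, w <- words n'] else [:: [::]].

Definition frame_sum n v : R := \sum_(w <- words n) cabs2 (inner mu v (fe w)).

Lemma frame_sum_ge0 n v : 0 <= frame_sum n v.
Proof. by apply: sumr_ge0 => w _; exact: cabs2_ge0. Qed.

Lemma frame_sumS n v : L2 mu v -> frame_sum n.+1 v = \sum_(l <- L) frame_sum n (Sadj l v).
Proof.
move=> hv; rewrite /frame_sum /= big_allpairs_dep; apply: eq_bigr => l _.
by apply: eq_bigr => w _; rewrite inner_frame_cons.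
Qed.

Lemma frame_sum0 v : frame_sum 0 v = cabs2 (inner mu v (fe [::])).
Proof. by rewrite /frame_sum /= big_seq1. Qed.

Lemma frame_sum_le n v : L2 mu v -> frame_sum n v <= nrm2 mu v.
Proof.
elim: n v => [|n IH] v hv.
  rewrite frame_sum0; apply: inner_unimodular_le => //; first exact/L2_cmeas/L2_frame_elt.
  by move=> x; rewrite frame_elt_nil cabs2_1.
rewrite frame_sumS // -nrm2_Sadj //; apply: ler_sum => l _; apply: IH; exact: L2_Sadj.
Qed.

(** Padding acts on the last letter while the recursion strips the first one. The induction thus
    reduces to levels 0 and 1, where [[:: 0]] carries the same function as the empty word and the
    other letters add nonnegative terms. *)
Lemma frame_sum_leS n v : L2 mu v -> frame_sum n v <= frame_sum n.+1 v.
Proof.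
elim: n v => [|n IH] v hv; last first.
  rewrite (frame_sumS n) // (frame_sumS n.+1) //; apply: ler_sum => l _; apply: IH;
    exact: L2_Sadj.
rewrite frame_sumS // (perm_big _ (perm_to_rem L0)) big_cons !frame_sum0.
have -> : inner mu v (fe [::]) = inner mu (Sadj 0 v) (fe [::]).
  rewrite -inner_frame_cons //; congr inner; apply/funext => x.
  rewrite frame_elt_nil /frame_elt big_seq1 alpha0 freq_cons freq_nil mulmx0 addr0.
  have -> : ivec R 0 = 0 :> 'cV[R]_d by apply/matrixP => i j; rewrite !mxE.
  by rewrite dot0l e2pi0 mulr1.
by rewrite lerDl sumr_ge0 // => l _; exact: frame_sum_ge0.
Qed.

Lemma frame_sum_nd v : L2 mu v -> nondecreasing_seq (frame_sum ^~ v).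
Proof. by move=> hv; apply/nondecreasing_seqP => n; exact: frame_sum_leS. Qed.

(** The levels on the two sides differ by one, so the equation of (iii) appears only after passing
    to the limit. *)
Lemma frame_sum_e2pi n t : frame_sum n.+1 (fun x => e2pi (dot t x)) =
  \sum_(l <- L) cabs2 (alpha l) * cabs2 (mB B (invmx (imat R A)^T *m (t - ivec R l))) *
    frame_sum n (fun x => e2pi (dot (invmx (imat R A)^T *m (t - ivec R l)) x)).
Proof.
rewrite frame_sumS; last exact: L2_e2pi.
apply: eq_bigr => l _; set s := invmx _ *m _.
have -> : Sadj l (fun x => e2pi (dot t x)) =
   (fun x => (Num.conj (alpha l) * mB B s) * e2pi (dot s x)).
  apply/funext => x; rewrite /Sadj /mB mulrCA -mulrA; congr (_ * _).
  rewrite -mulrA mulr_suml mulr_sumr; apply: eq_bigr => b _.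
  rewrite rmorphM /= mulrCA -e2piN -e2piD -dotNl -dotDl; congr (_ * _).
  have -> : dot (t - ivec R l) (tau A b x) = dot s (x + ivec R b).
    by rewrite /s /tau -trmx_inv dot_mulmx.
  by rewrite dotDr e2piD mulrC [dot (ivec R b) s]dotC.
rewrite /frame_sum mulr_sumr; apply: eq_bigr => w _.
rewrite innerZ; [|exact: L2_e2pi|exact: L2_frame_elt].
by rewrite !cabs2M cabs2J.
Qed.
End frame.

(** * Bessel families *)

Section cnorm.
Variable R : realType.
Implicit Types a b z : complex R.

(** The norm of [complex R] is valued in [complex R]; this real version is open to real arithmetic
    and real limits. *)
Definition cnorm z : R := Num.sqrt (cabs2 z).

Lemma cnormE z : `|z| = ((cnorm z)%:C)%C.
Proof. by rewrite normc_def. Qed.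
Lemma cnorm_ge0 z : 0 <= cnorm z.
Proof. exact: sqrtr_ge0. Qed.
Lemma sqr_cnorm z : cnorm z ^+ 2 = cabs2 z.
Proof. by rewrite sqr_sqrtr // cabs2_ge0. Qed.
Lemma cnormD a b : cnorm (a + b) <= cnorm a + cnorm b.
Proof. by rewrite -lecR rmorphD /= -!cnormE ler_normD. Qed.
Lemma cnormM a b : cnorm (a * b) = cnorm a * cnorm b.
Proof. by rewrite /cnorm cabs2M sqrtrM // cabs2_ge0. Qed.
Lemma cnormJ a : cnorm (Num.conj a) = cnorm a.
Proof. by rewrite /cnorm cabs2J. Qed.
Lemma cnorm0 : cnorm 0 = 0.
Proof. by rewrite /cnorm cabs2_0 sqrtr0. Qed.
Lemma cnorm_real (x : R) : cnorm ((x%:C)%C) = `|x|.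
Proof. by rewrite /cnorm cabs2_real sqrtr_sqr. Qed.
Lemma cnorm_le a (x : R) : 0 <= x -> (cnorm a <= x) = (cabs2 a <= x ^+ 2).
Proof. by move=> x0; rewrite -sqr_cnorm ler_sqr // nnegrE cnorm_ge0. Qed.
Lemma cnorm_sum (I : Type) (s : seq I) (F : I -> complex R) :
  cnorm (\sum_(i <- s) F i) <= \sum_(i <- s) cnorm (F i).
Proof.
elim: s => [|i s IH]; first by rewrite !big_nil cnorm0.
by rewrite !big_cons; apply: le_trans (cnormD _ _) _; rewrite lerD2l.
Qed.
Lemma Re_le_cnorm a : `|complex.Re a| <= cnorm a.
Proof.
by rewrite -ler_sqr ?nnegrE ?cnorm_ge0 // sqr_cnorm real_normK ?num_real // lerDl sqr_ge0.
Qed.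
Lemma cRe_sum (I : Type) (s : seq I) (F : I -> complex R) :
  complex.Re (\sum_(i <- s) F i) = \sum_(i <- s) complex.Re (F i).
Proof. by elim: s => [|i s IH]; rewrite ?big_nil // !big_cons cReD IH. Qed.
Lemma cIm_sum (I : Type) (s : seq I) (F : I -> complex R) :
  complex.Im (\sum_(i <- s) F i) = \sum_(i <- s) complex.Im (F i).
Proof. by elim: s => [|i s IH]; rewrite ?big_nil // !big_cons cImD IH. Qed.

(** Stated on real and imaginary parts, so that monotone and dominated convergence of real sequences
    apply directly. *)
Definition ccvg (a : nat -> complex R) (l : complex R) :=
  (complex.Re (a n) @[n --> \oo] --> complex.Re l) /\
  (complex.Im (a n) @[n --> \oo] --> complex.Im l).

Lemma ccvgD (l m : complex R) (u v : nat -> complex R) :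
  ccvg u l -> ccvg v m -> ccvg (fun n => u n + v n) (l + m).
Proof.
move=> [u1 u2] [v1 v2]; split.
  by rewrite cReD; under eq_fun do rewrite cReD; exact: cvgD.
by rewrite cImD; under eq_fun do rewrite cImD; exact: cvgD.
Qed.

Lemma ccvgZ (c l : complex R) (u : nat -> complex R) :
  ccvg u l -> ccvg (fun n => c * u n) (c * l).
Proof.
move=> [u1 u2]; split.
  by rewrite cReM; under eq_fun do rewrite cReM; apply: cvgB; apply: cvgM => //; exact: cvg_cst.
by rewrite cImM; under eq_fun do rewrite cImM; apply: cvgD; apply: cvgM => //; exact: cvg_cst.
Qed.

Lemma ccvg_sum (I : Type) (s : seq I) (u : I -> nat -> complex R) (l : I -> complex R) :
  (forall i, ccvg (u i) (l i)) -> ccvg (fun n => \sum_(i <- s) u i n) (\sum_(i <- s) l i).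
Proof.
move=> h; elim: s => [|i s IH].
  by rewrite big_nil; under eq_fun do rewrite big_nil; split; exact: cvg_cst.
by rewrite big_cons; under eq_fun do rewrite big_cons; exact: ccvgD.
Qed.

Lemma ccvg_cnorm_le (u : nat -> complex R) (l : complex R) (C : R) : 0 <= C ->
  ccvg u l -> (forall n, cnorm (u n) <= C) -> cnorm l <= C.
Proof.
move=> C0 [u1 u2] h; rewrite cnorm_le //.
have hc : cabs2 (u n) @[n --> \oo] --> cabs2 l.
  by apply: cvgD; rewrite expr2; under eq_fun do rewrite expr2; exact: cvgM.
by apply: (cvgr_to_le hc); apply: nearW => n; rewrite -cnorm_le.
Qed.
End cnorm.

Section bessel.
Variables (R : realType) (d : nat) (mu : probability (Rd R d) R).
Variables (I : eqType) (ws : nat -> seq I) (F : I -> 'cV[R]_d -> complex R).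
Implicit Types u v : 'cV[R]_d -> complex R.
Hypothesis FL2 : forall w, L2 mu (F w).

Definition bessel_sum n v : R := \sum_(w <- ws n) cabs2 (inner mu v (F w)).

Hypothesis bessel : forall n v, L2 mu v -> bessel_sum n v <= nrm2 mu v.
Hypothesis bessel_sum_nd : forall v, L2 mu v -> nondecreasing_seq (bessel_sum ^~ v).

Definition bessel_lim v : R := limn (bessel_sum ^~ v).

Lemma bessel_sum_ge0 n v : 0 <= bessel_sum n v.
Proof. by apply: sumr_ge0 => w _; exact: cabs2_ge0. Qed.

Lemma bessel_sum_cvg v : L2 mu v -> bessel_sum n v @[n --> \oo] --> bessel_lim v.
Proof.
move=> hv; apply: nondecreasing_is_cvgn; first exact: bessel_sum_nd.
by exists (nrm2 mu v) => _ [n _ <-]; exact: bessel.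
Qed.

Lemma bessel_sum_le_lim n v : L2 mu v -> bessel_sum n v <= bessel_lim v.
Proof. by move=> hv; apply: nondecreasing_cvgn_le;
  [exact: bessel_sum_nd|exact: bessel_sum_cvg]. Qed.

Lemma bessel_lim_le v : L2 mu v -> bessel_lim v <= nrm2 mu v.
Proof. by move=> hv; apply: (cvgr_to_le (bessel_sum_cvg hv)); apply: nearW => n;
  exact: bessel. Qed.

Definition gram_sum n u v : complex R :=
  \sum_(w <- ws n) inner mu u (F w) * Num.conj (inner mu v (F w)).

Lemma gram_sumDl n u u' v : L2 mu u -> L2 mu u' ->
  gram_sum n (fun x => u x + u' x) v = gram_sum n u v + gram_sum n u' v.
Proof.
move=> hu hu'; rewrite /gram_sum -big_split; apply: eq_bigr => w _.
by rewrite innerD // mulrDl.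
Qed.

Lemma gram_sumDr n u v v' : L2 mu v -> L2 mu v' ->
  gram_sum n u (fun x => v x + v' x) = gram_sum n u v + gram_sum n u v'.
Proof.
move=> hu hu'; rewrite /gram_sum -big_split; apply: eq_bigr => w _.
by rewrite innerD // rmorphD mulrDr.
Qed.

Lemma gram_sum_suml n (m : nat) (U : 'I_m -> 'cV[R]_d -> complex R) (c : 'I_m -> complex R) v :
  (forall j, L2 mu (U j)) ->
  gram_sum n (fun x => \sum_j c j * U j x) v = \sum_j c j * gram_sum n (U j) v.
Proof.
move=> hU; rewrite /gram_sum.
under eq_bigr => w _.
  rewrite (inner_sum (F := fun j x => c j * U j x)) //; last by move=> j _; exact: L2Z.
  over.
elim: (ws n) => [|w s IH].
  by rewrite big_nil big1 // => j _; rewrite big_nil mulr0.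
rewrite big_cons IH mulr_suml -big_split /=; apply: eq_bigr => j _.
by rewrite big_cons innerZ // mulrDr mulrA.
Qed.

(** The form is conjugate-linear in its second argument, so conjugated coefficients come out plain.
    This is what makes the derivative of [hlim] complex-linear. *)
Lemma gram_sum_sumr n (m : nat) (U : 'I_m -> 'cV[R]_d -> complex R) (c : 'I_m -> complex R) u :
  (forall j, L2 mu (U j)) ->
  gram_sum n u (fun x => \sum_j Num.conj (c j) * U j x) = \sum_j c j * gram_sum n u (U j).
Proof.
move=> hU; rewrite /gram_sum.
under eq_bigr => w _.
  rewrite (inner_sum (F := fun j x => Num.conj (c j) * U j x)) //; last by move=> j _; exact: L2Z.
  over.
elim: (ws n) => [|w s IH].
  by rewrite big_nil big1 // => j _; rewrite big_nil mulr0.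
rewrite big_cons IH rmorph_sum mulr_sumr -big_split /=; apply: eq_bigr => j _.
by rewrite big_cons innerZ // rmorphM /= conjCK mulrDr; congr (_ + _); rewrite mulrCA.
Qed.

(** The inequality of arithmetic and geometric means, term by term, in place of Cauchy-Schwarz. The
    free weight [s] balances functions of different size: it will be 1 for two first-order terms,
    and [m ^+ 2] or its inverse when one of them is a second-order remainder. *)
Lemma gram_sum_le n u v (s : R) : 0 < s -> L2 mu u -> L2 mu v ->
  cnorm (gram_sum n u v) <= (nrm2 mu u / s + s * nrm2 mu v) / 2.
Proof.
move=> s0 hu hv; apply: le_trans (cnorm_sum _ _) _.
apply: (@le_trans _ _ ((bessel_sum n u / s + s * bessel_sum n v) / 2)); last first.
  have s1 : 0 <= s^-1 by rewrite invr_ge0 ltW.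
  apply: ler_wpM2r => //; apply: lerD; first by apply: ler_wpM2r => //; exact: bessel.
  by apply: ler_wpM2l; [exact: ltW|exact: bessel].
rewrite /bessel_sum mulr_suml mulr_sumr -big_split /= mulr_suml; apply: ler_sum => w _.
rewrite cnormM cnormJ -!sqr_cnorm; set a := cnorm _; set b := cnorm _.
have := sqr_ge0 (a / s - b).
rewrite -(pmulr_rge0 _ s0) => h.
have -> : a ^+ 2 / s + s * b ^+ 2 = s * (a / s - b) ^+ 2 + 2 * (a * b).
  by field; rewrite gt_eqF.
lra.
Qed.

(** Polarization of [bessel_lim]. The sums [gram_sum] are not monotone in [n], but each is a
    combination of [bessel_sum], which are. *)
Definition gram_lim u v : complex R :=
  (((bessel_lim (fun x => u x + v x) - bessel_lim (fun x => u x + (-1) * v x)) / 4) +i*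
   ((bessel_lim (fun x => u x + 'i%C * v x) - bessel_lim (fun x => u x + (- 'i%C) * v x)) / 4))%C.

Lemma gram_sum_cvg u v : L2 mu u -> L2 mu v -> ccvg (fun n => gram_sum n u v) (gram_lim u v).
Proof.
move=> hu hv; have hc (c : complex R) : L2 mu (fun x => u x + c * v x).
  by apply: L2D => //; exact: L2Z.
have QnE n (c : complex R) : bessel_sum n (fun x => u x + c * v x) =
    \sum_(w <- ws n) cabs2 (inner mu u (F w) + c * inner mu v (F w)).
  by apply: eq_bigr => w _; rewrite innerD ?innerZ //; exact: L2Z.
split => /=.
  have -> : (fun x => u x + v x) = (fun x => u x + 1 * v x) by apply/funext => x; rewrite mul1r.
  rewrite [X in X @ _ --> _](_ : _ = (fun n =>
     (bessel_sum n (fun x => u x + 1 * v x) - bessel_sum n (fun x => u x + (-1) * v x)) / 4));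
       last first.
    apply/funext => n; rewrite !QnE -sumrB mulr_suml cRe_sum; apply: eq_bigr => w _.
    by move: (inner mu u (F w)) (inner mu v (F w)) => [a b] [c e]; rewrite /cabs2 /=; field.
  by apply: cvgM; [apply: cvgB; exact: bessel_sum_cvg|exact: cvg_cst].
rewrite [X in X @ _ --> _](_ : _ = (fun n =>
   (bessel_sum n (fun x => u x + 'i%C * v x) - bessel_sum n (fun x => u x + (- 'i%C) * v x)) /
     4)); last first.
  apply/funext => n; rewrite !QnE -sumrB mulr_suml cIm_sum; apply: eq_bigr => w _.
  by move: (inner mu u (F w)) (inner mu v (F w)) => [a b] [c e]; rewrite /cabs2 /=; field.
by apply: cvgM; [apply: cvgB; exact: bessel_sum_cvg|exact: cvg_cst].
Qed.

Lemma gram_sum_diag n u : gram_sum n u u = ((bessel_sum n u)%:C)%C.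
Proof.
rewrite /gram_sum /bessel_sum; elim: (ws n) => [|w s IH]; first by rewrite !big_nil.
by rewrite !big_cons IH rmorphD /= cabs2C.
Qed.

Lemma gram_lim_diag u : L2 mu u -> gram_lim u u = ((bessel_lim u)%:C)%C.
Proof.
move=> hu; have [g1 g2] := gram_sum_cvg hu hu; apply: complex_eqP => /=.
  move: g1; under eq_fun do rewrite gram_sum_diag /=; move=> g1.
  exact: (cvg_unique _ g1 (bessel_sum_cvg hu)).
move: g2; under eq_fun do rewrite gram_sum_diag /=; move=> g2.
exact: (cvg_unique _ g2 (cvg_cst _)).
Qed.
End bessel.

(** * Complex exponentials *)

Section cexp.
Variable R : realType.

Lemma normr_sin_le (q : R) : 0 <= q -> `|sin q| <= q.
Proof.
move=> q0; have [|c _] := @MVT_segment R (@sin R) (@cos R) 0 q q0.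
  by apply: continuous_subspaceT => x; exact: continuous_sin.
rewrite sin0 !subr0 => ->; rewrite normrM [X in _ * X]ger0_norm //.
by rewrite ler_piMl // ler_norml cos_geN1 cos_le1.
Qed.

Lemma normr_cosB1_le (q : R) : `|cos q - 1| <= q ^+ 2.
Proof.
wlog q0 : q / 0 <= q => [h|].
  have [/h//|/ltW q0] := leP 0 q.
  by rewrite -cosN -sqrrN; apply: h; rewrite oppr_ge0.
have [|c] := @MVT_segment R (@cos R) (fun x => - sin x) 0 q q0.
  by apply: continuous_subspaceT => x; exact: continuous_cos.
rewrite in_itv /= => /andP[c0 cq]; rewrite cos0 subr0 => ->.
rewrite normrM normrN [X in _ * X]ger0_norm // expr2 ler_wpM2r //.
exact: le_trans (normr_sin_le c0) cq.
Qed.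

Lemma normr_sinB_le (q : R) : `|q| <= 1 -> `|sin q - q| <= q ^+ 2.
Proof.
wlog q0 : q / 0 <= q => [h q1|].
  have [/h->//|/ltW q0] := leP 0 q.
  rewrite -normrN opprB addrC -sinN -[X in _ + X]opprK -sqrrN; apply: h; last by rewrite normrN.
  by rewrite oppr_ge0.
rewrite ger0_norm // => q1.
have [|c] := @MVT_segment R (@sin R) (@cos R) 0 q q0.
  by apply: continuous_subspaceT => x; exact: continuous_sin.
rewrite in_itv /= => /andP[c0 cq]; rewrite sin0 !subr0 => ->.
rewrite -{2}[q]mul1r -mulrBl normrM [X in _ * X]ger0_norm // expr2 ler_wpM2r //.
apply: le_trans (normr_cosB1_le c) _; rewrite expr2.
by nra.
Qed.

(** Below, the tangent bound at [p]. Above, the one at [- p]: [expR (- p) >= 1 - p] gives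
    [expR p <= 1 / (1 - p)], whose excess over [1 + p] is [p^2 / (1 - p) <= 2 p^2]. *)
Lemma expR_taylor1 (p : R) : `|p| <= 2^-1 -> `|expR p - 1 - p| <= 2 * p ^+ 2.
Proof.
rewrite ler_norml => /andP[p1 p2].
have h1 := expR_ge1Dx p; have h2 := expR_ge1Dx (- p).
rewrite ger0_norm; last by lra.
have h3 : expR p * expR (- p) = 1 by rewrite -expRD subrr expR0.
have h4 : expR p * (1 - p) <= 1 by rewrite -[leRHS]h3 ler_pM2l ?expR_gt0.
nra.
Qed.

Definition cexp (c : complex R) : complex R :=
  ((expR (complex.Re c) * cos (complex.Im c)) +i* (expR (complex.Re c) * sin (complex.Im c)))%C.

Lemma cexpD (a b : complex R) : cexp (a + b) = cexp a * cexp b.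
Proof.
by apply: complex_eqP; rewrite ?cReM ?cImM /cexp /= cReD cImD expRD ?cosD ?sinD; ring.
Qed.

(** The hypothesis keeps both parts of [c] within [1 / 2], where the real expansions apply. With [D]
    the squared modulus, the remainder has real part at most [4 D] and imaginary part at most [6 D]
    in absolute value, and [16 + 36 <= 100]. *)
Lemma cexp_taylor1 (c : complex R) : cabs2 c <= 4^-1 ->
  cabs2 (cexp c - 1 - c) <= 100 * cabs2 c ^+ 2.
Proof.
case: c => p q; rewrite /cabs2 /= => h.
have p1 : `|p| <= 2^-1 by rewrite ler_norml; apply/andP; split; nra.
have q1 : `|q| <= 1 by rewrite ler_norml; apply/andP; split; nra.
have := expR_taylor1 p1; have := normr_cosB1_le q; have := normr_sinB_le q1.
move: p1 q1; rewrite !ler_norml => /andP[p1 p2] /andP[q1 q2] /andP[s1 s2] /andP[c1 c2] /andP[e1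
  e2].
rewrite subr0.
set E := expR p in e1 e2 *; set c := cos q in c1 c2 *; set s := sin q in s1 s2 *.
have E0 : 0 <= E by exact: expR_ge0.
have E2 : E <= 2 by nra.
have re1 : - (4 * (p ^+ 2 + q ^+ 2)) <= E * c - 1 - p <= 4 * (p ^+ 2 + q ^+ 2).
  have -> : E * c - 1 - p = E * (c - 1) + (E - 1 - p) by ring.
  by apply/andP; split; nra.
have pq : - (p ^+ 2 + q ^+ 2) <= 2 * (p * q) <= p ^+ 2 + q ^+ 2.
  by have := sqr_ge0 (p + q); have := sqr_ge0 (p - q) => *; apply/andP; split; nra.
have im1 : - (6 * (p ^+ 2 + q ^+ 2)) <= E * s - q <= 6 * (p ^+ 2 + q ^+ 2).
  have -> : E * s - q = E * (s - q) + (E - 1 - p) * q + p * q by ring.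
  have : -(p ^+ 2) * 2 <= (E - 1 - p) * q <= 2 * p ^+ 2 by apply/andP; split; nra.
  by move=> /andP[? ?]; apply/andP; split; nra.
move: re1 im1 => /andP[r1 r2] /andP[i1 i2].
set D := p ^+ 2 + q ^+ 2 in r1 r2 i1 i2 *.
by nra.
Qed.
End cexp.

(** * Differentiability from a quadratic remainder *)

Definition linform (K : numFieldType) (d : nat) (c : 'I_d -> K) (z : 'cV[K]_d) : K^o :=
  \sum_j z j 0 * c j.

Lemma linform_is_linear (K : numFieldType) d (c : 'I_d -> K) : linear (linform c).
Proof.
move=> a x y; rewrite /linform scaler_sumr -big_split /=; apply: eq_bigr => j _.
by rewrite !mxE mulrDl -mulrA.
Qed.
HB.instance Definition _ (K : numFieldType) d (c : 'I_d -> K) :=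
  GRing.isLinear.Build K 'cV[K]_d K^o _ (linform c) (linform_is_linear c).

Lemma linform_continuous (K : numFieldType) d (c : 'I_d -> K) :
  continuous (linform c : 'cV[K]_d -> K^o).
Proof.
apply: continuous_big => [|j _ x]; first exact: add_continuous.
have h : (fun z : 'cV[K]_d => z j 0) z @[z --> x] --> x j 0 by exact: (@coord_continuous K d 1 j
  0 x).
exact: (cvgM h (cvg_cst (c j))).
Qed.

(** A quadratic remainder is [o(w)], which identifies [df] as the differential. Norms are valued in
    [K], so over [complex R] the bounds [C] and [e] are themselves complex. *)
Lemma differentiable_quadratic (K : numFieldType) (V W : normedModType K) (f : V -> W)
    (df : {linear V -> W}) (z : V) (C e : K) : continuous df -> 0 < C -> 0 < e ->
  (forall w, `|w| < e -> `|f (w + z) - f z - df w| <= C * `|w| ^+ 2) ->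
  differentiable f z.
Proof.
move=> cdf C0 e0 h.
have ho : f \o shift z = cst (f z) + df +o_0 id.
  apply/eqaddoP => eps eps0; near=> w => /=.
  rewrite [X in `|X|](_ : _ = f (w + z) - f z - df w); last first.
    by rewrite -[(_ - _) w]/(f (w + z) - (f z + df w)) opprD addrA.
  have we : `|w| < e by near: w; exact: nbhs0_lt.
  apply: le_trans (h w we) _; rewrite expr2 mulrA ler_wpM2r //.
  rewrite -ler_pdivlMl //; apply: ltW; near: w.
  by apply: nbhs0_lt; rewrite mulr_gt0 // invr_gt0.
by apply/diff_locallyP; rewrite (diff_unique cdf ho).
Unshelve. all: by end_near. Qed.

Lemma ler_coord_mx_norm (K : numDomainType) m n (x : 'M[K]_(m, n)) i j : `|x i j| <= `|x|.
Proof.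
rewrite [leRHS]/Num.norm /= mx_normE.
have h := le_bigmax (0%:nng) (fun p : 'I_m * 'I_n => `|x p.1 p.2|%:nng) (i, j).
exact: h.
Qed.

(** * Exponentials of complex frequency on a bounded set *)

Section cutexp.
Variables (R : realType) (d : nat) (M : R).
Hypothesis M0 : 0 <= M.
Implicit Types (z w : 'cV[complex R]_d) (x : 'cV[R]_d).

Definition supp : set (Rd R d) := [set x | l1norm x <= M].

(** This is [2 pi i z . x]; on [supp] its modulus is at most [2 pi M], called [kappa] below, times
    the largest [|z_j|]. *)
Definition lin (z : 'cV[complex R]_d) (x : 'cV[R]_d) : complex R :=
  \sum_j z j 0 * ((0 +i* (2 * pi * x j 0))%C).

(** The cut-off gives bounds valid at every point, while for [supp] of full measure it changes no
    integral. *)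
Definition cutexp (z : 'cV[complex R]_d) (x : 'cV[R]_d) : complex R :=
  ((\1_supp x)%:C)%C * cexp (lin z x).

Definition cutexp_der (z : 'cV[complex R]_d) (j : 'I_d) (x : 'cV[R]_d) : complex R :=
  ((0 +i* (2 * pi * x j 0))%C) * cutexp z x.

Lemma linD z w x : lin (z + w) x = lin z x + lin w x.
Proof. by rewrite /lin -big_split /=; apply: eq_bigr => j _; rewrite mxE mulrDl. Qed.

Lemma lin_mul_cutexp w z x : lin w x * cutexp z x = \sum_j w j 0 * cutexp_der z j x.
Proof. by rewrite /lin mulr_suml; apply: eq_bigr => j _; rewrite -mulrA. Qed.

Lemma cnorm_lin z x (m : R) : (forall j, cnorm (z j 0) <= m) -> cnorm (lin z x) <= 2 * pi * m *
  l1norm x.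
Proof.
move=> h; apply: le_trans (cnorm_sum _ _) _; rewrite /l1norm mulr_sumr.
apply: ler_sum => j _; rewrite cnormM.
have -> : cnorm ((0 +i* (2 * pi * x j 0))%C) = 2 * pi * `|x j 0|.
  rewrite /cnorm /cabs2 /= expr0n add0r sqrtr_sqr normrM ger0_norm //.
  by rewrite mulr_ge0 // pi_ge0.
have p0 : 0 <= 2 * pi * `|x j 0| by rewrite mulr_ge0 // mulr_ge0 // pi_ge0.
apply: le_trans (ler_wpM2r p0 (h j)) _.
by rewrite (_ : m * _ = 2 * pi * m * `|x j 0|) //; ring.
Qed.

Notation kappa := (2 * pi * M).

Lemma kappa_ge0 : 0 <= kappa.
Proof. by rewrite mulr_ge0 // mulr_ge0 // pi_ge0. Qed.

Lemma cnorm_lin_supp z x (m : R) : 0 <= m -> (forall j, cnorm (z j 0) <= m) -> supp x ->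
  cnorm (lin z x) <= kappa * m.
Proof.
move=> m0 h sx; apply: le_trans (cnorm_lin x h) _.
have : l1norm x <= M by [].
have p0 : 0 <= 2 * pi * m by rewrite mulr_ge0 // mulr_ge0 // pi_ge0.
by move=> /(ler_wpM2l p0); rewrite [X in _ -> _ <= X]mulrAC.
Qed.

Lemma cmeas_lin z : cmeas (lin z).
Proof.
apply: cmeas_sum => j _; apply: cmeasM; first exact: cmeas_cst.
split => /=; first exact: measurable_cst.
by apply: measurable_funM => //; exact: measurable_coord.
Qed.

Lemma cmeas_cexp (f : 'cV[R]_d -> complex R) : cmeas f -> cmeas (fun x => cexp (f x)).
Proof.
move=> [f1 f2].
have me : measurable_fun [set: Rd R d] (fun x : Rd R d => expR (complex.Re (f x))).
  by apply: measurableT_comp f1; exact: measurable_expR.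
split => /=; apply: measurable_funM => //.
  by apply: measurableT_comp f2; apply: continuous_measurable_fun; exact: continuous_cos.
by apply: measurableT_comp f2; apply: continuous_measurable_fun; exact: continuous_sin.
Qed.

Lemma measurable_supp : measurable supp.
Proof. exact: measurable_l1norm_le. Qed.

Lemma cmeas_supp : cmeas (fun x => ((\1_supp x)%:C)%C : complex R).
Proof. by apply: cmeas_real; exact: measurable_indic measurable_supp. Qed.

Lemma cmeas_cutexp z : cmeas (cutexp z).
Proof. by apply: cmeasM; [exact: cmeas_supp|apply: cmeas_cexp; exact: cmeas_lin]. Qed.

Lemma cabs2_cexp (c : complex R) : cabs2 (cexp c) = expR (complex.Re c) ^+ 2.
Proof.
rewrite /cabs2 /cexp /= !exprMn -mulrDr cos2Dsin2 mulr1 //.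
Qed.

Lemma cutexp_notin z x : ~ supp x -> cutexp z x = 0.
Proof. by move=> h; rewrite /cutexp indicE memNset // mul0r. Qed.

Lemma cutexp_in z x : supp x -> cutexp z x = cexp (lin z x).
Proof. by move=> h; rewrite /cutexp indicE mem_set // mul1r. Qed.

Lemma cabs2_cutexp_le z x (m : R) : 0 <= m -> (forall j, cnorm (z j 0) <= m) ->
  cabs2 (cutexp z x) <= expR (kappa * m) ^+ 2.
Proof.
move=> m0 h; have [sx|sx] := pselect (supp x); last first.
  by rewrite cutexp_notin // cabs2_0 sqr_ge0.
rewrite cutexp_in // cabs2_cexp ler_sqr ?nnegrE ?expR_ge0 // ler_expR.
exact: le_trans (le_trans (ler_norm _) (Re_le_cnorm _)) (cnorm_lin_supp m0 h sx).
Qed.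

Definition cutexp_rem z w (x : 'cV[R]_d) : complex R := cutexp z x * (cexp (lin w x) - 1 - lin w
  x).

Lemma cmeas_cutexp_rem z w : cmeas (cutexp_rem z w).
Proof.
apply: cmeasM; first exact: cmeas_cutexp.
have -> : (fun x => cexp (lin w x) - 1 - lin w x) =
  (fun x => (cexp (lin w x) + -1) + (-1) * lin w x) by apply/funext => x; rewrite mulN1r.
apply: cmeasD; first by apply: cmeasD; [apply: cmeas_cexp; exact: cmeas_lin|exact: cmeas_cst].
by apply: cmeasM; [exact: cmeas_cst|exact: cmeas_lin].
Qed.

Lemma cutexp_shift z w x : cutexp (w + z) x = cutexp z x + lin w x * cutexp z x + cutexp_rem z w
  x.
Proof. by rewrite /cutexp_rem /cutexp linD cexpD; ring. Qed.

Lemma cabs2_lin_cutexp_le z w x (m E : R) : 0 <= m -> 0 <= E ->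
  (forall x, cabs2 (cutexp z x) <= E) -> (forall j, cnorm (w j 0) <= m) ->
  cabs2 (lin w x * cutexp z x) <= E * (kappa * m) ^+ 2.
Proof.
move=> m0 E0 hE h; have [sx|sx] := pselect (supp x); last first.
  by rewrite cutexp_notin // mulr0 cabs2_0 mulr_ge0 // sqr_ge0.
rewrite cabs2M mulrC; apply: ler_pM => //; try exact: cabs2_ge0.
rewrite -cnorm_le; first exact: cnorm_lin_supp.
by rewrite mulr_ge0 // kappa_ge0.
Qed.

Lemma cabs2_cutexp_rem_le z w x (m E : R) : 0 <= m -> 0 <= E -> kappa * m <= 2^-1 ->
  (forall x, cabs2 (cutexp z x) <= E) -> (forall j, cnorm (w j 0) <= m) ->
  cabs2 (cutexp_rem z w x) <= E * (100 * (kappa * m) ^+ 4).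
Proof.
move=> m0 E0 km hE h; have km0 : 0 <= kappa * m by rewrite mulr_ge0 // kappa_ge0.
have [sx|sx] := pselect (supp x); last first.
  by rewrite /cutexp_rem cutexp_notin // mul0r cabs2_0 mulr_ge0 // mulr_ge0 // exprn_ge0.
rewrite /cutexp_rem cabs2M; apply: ler_pM => //; try exact: cabs2_ge0.
have hl : cabs2 (lin w x) <= (kappa * m) ^+ 2 by rewrite -cnorm_le //; exact: cnorm_lin_supp.
apply: le_trans (cexp_taylor1 _) _.
  by apply: le_trans hl _; move: km km0; set k := kappa * m; nra.
rewrite ler_wpM2l // (_ : 4%N = (2 * 2)%N) // exprM ler_sqr // nnegrE ?cabs2_ge0 ?sqr_ge0 //.
Qed.
End cutexp.

(** * The limit of the Gram sums is entire *)

Section entire.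
Variables (R : realType) (d : nat) (mu : probability (Rd R d) R).
Variables (I : eqType) (ws : nat -> seq I) (F : I -> 'cV[R]_d -> complex R).
Hypothesis FL2 : forall w, L2 mu (F w).
Hypothesis bessel : forall n v, L2 mu v -> bessel_sum mu ws F n v <= nrm2 mu v.
Hypothesis bessel_sum_nd : forall v, L2 mu v -> nondecreasing_seq ((bessel_sum mu ws F) ^~ v).
Variable (M : R).
Hypothesis M0 : 0 <= M.

Notation gram_sum := (gram_sum mu ws F).
Notation gram_lim := (gram_lim mu ws F).
Notation cutexp := (cutexp M).
Notation kappa := (2 * pi * M).

Lemma L2_cutexp z : L2 mu (cutexp z).
Proof.
pose m := \sum_j cnorm (z j 0).
have hm j : cnorm (z j 0) <= m.
  by rewrite /m (bigD1 j) //= lerDl sumr_ge0 // => *; exact: cnorm_ge0.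
have m0 : 0 <= m by apply: sumr_ge0 => *; exact: cnorm_ge0.
apply: (L2_bounded mu (M := expR (kappa * m) ^+ 2)); first exact: cmeas_cutexp.
by move=> x; exact: cabs2_cutexp_le.
Qed.

Lemma L2_cutexp_der z j : L2 mu (cutexp_der M z j).
Proof.
pose w : 'cV[complex R]_d := \col_i (i == j)%:R.
have hw i : cnorm (w i 0) <= 1.
  rewrite mxE; case: eqP => _; first by rewrite (cnorm_real 1) normr1.
  by rewrite cnorm0.
have -> : cutexp_der M z j = (fun x => lin w x * cutexp z x).
  apply/funext => x; rewrite lin_mul_cutexp (bigD1 j) //= big1 ?addr0 => [|i ij].
    by rewrite mxE eqxx mul1r.
  by rewrite mxE (negPf ij) mul0r.
pose m := \sum_j cnorm (z j 0).
have hm i : cnorm (z i 0) <= m.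
  by rewrite /m (bigD1 i) //= lerDl sumr_ge0 // => *; exact: cnorm_ge0.
have m0 : 0 <= m by apply: sumr_ge0 => *; exact: cnorm_ge0.
apply: (L2_bounded mu (M := expR (kappa * m) ^+ 2 * (kappa * 1) ^+ 2)).
  by apply: cmeasM; [exact: cmeas_lin|exact: cmeas_cutexp].
by move=> x; apply: cabs2_lin_cutexp_le; rewrite ?sqr_ge0 // => y; exact: cabs2_cutexp_le.
Qed.

(** Write [cutexp (w + z)] as [cutexp z + a + r], and likewise [cutexp (v + y)] with [a'] and [r'].
    Orders 0 and 1 cancel and leave the pairings of [a] with [a'], of [r] with [cutexp (v + y)], and
    of [cutexp z + a] with [r']. They are bounded with weights [1], [m ^+ 2] and its inverse, and
    give the three summands of the constant in this order, uniformly in [n]. *)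
Lemma gram_sum_remainder n (z y w v : 'cV[complex R]_d) (m E : R) : 0 < m -> 0 <= E -> kappa * m
  <= 2^-1 ->
  (forall x, cabs2 (cutexp z x) <= E) -> (forall x, cabs2 (cutexp y x) <= E) ->
  (forall x, cabs2 (cutexp (v + y) x) <= E) ->
  (forall j, cnorm (w j 0) <= m) -> (forall j, cnorm (v j 0) <= m) ->
  cnorm (gram_sum n (cutexp (w + z)) (cutexp (v + y)) - gram_sum n (cutexp z) (cutexp y)
      - (gram_sum n (fun x => lin w x * cutexp z x) (cutexp y) + gram_sum n (cutexp z) (fun x =>
        lin v x * cutexp y x)))
  <= (E * kappa ^+ 2 + (100 * E * kappa ^+ 4 + E) / 2 + (4 * E + 100 * E * kappa ^+ 4) / 2)
     * m ^+ 2.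
Proof.
move=> m0 E0 km hz hy hvy hw hv; have m0' := ltW m0.
pose a x : complex R := lin w x * cutexp z x; pose a' x : complex R := lin v x * cutexp y x.
have ha x : cabs2 (a x) <= E * (kappa * m) ^+ 2 by exact: cabs2_lin_cutexp_le.
have ha' x : cabs2 (a' x) <= E * (kappa * m) ^+ 2 by exact: cabs2_lin_cutexp_le.
have hr x : cabs2 (cutexp_rem M z w x) <= E * (100 * (kappa * m) ^+ 4) by exact:
  cabs2_cutexp_rem_le.
have hr' x : cabs2 (cutexp_rem M y v x) <= E * (100 * (kappa * m) ^+ 4) by exact:
  cabs2_cutexp_rem_le.
have ma : cmeas a by apply: cmeasM; [exact: cmeas_lin|exact: cmeas_cutexp].
have ma' : cmeas a' by apply: cmeasM; [exact: cmeas_lin|exact: cmeas_cutexp].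
have mr := cmeas_cutexp_rem M z w; have mr' := cmeas_cutexp_rem M y v.
have La := L2_bounded mu ma ha; have La' := L2_bounded mu ma' ha'.
have Lr := L2_bounded mu mr hr; have Lr' := L2_bounded mu mr' hr'.
have Na := nrm2_le_bounded mu ma ha; have Na' := nrm2_le_bounded mu ma' ha'.
have Nr := nrm2_le_bounded mu mr hr; have Nr' := nrm2_le_bounded mu mr' hr'.
have Nz := nrm2_le_bounded mu (cmeas_cutexp M z) hz.
have Nvy := nrm2_le_bounded mu (cmeas_cutexp M (v + y)) hvy.
have Lza : L2 mu (fun x => cutexp z x + a x) by apply: L2D => //; exact: L2_cutexp.
have hza x : cabs2 (cutexp z x + a x) <= 4 * E.
  apply: le_trans (cabs2D_le _ _) _.
  have k1 : (kappa * m) ^+ 2 <= 1.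
    have : 0 <= kappa * m by rewrite mulr_ge0 // kappa_ge0.
    by move: km; set k := kappa * m; nra.
  have := ler_wpM2l E0 k1; have := ha x; have := hz x; set k := kappa * m; lra.
have Nza := nrm2_le_bounded mu (cmeasD (cmeas_cutexp M z) ma) hza.
have E1 : gram_sum n (cutexp (w + z)) (cutexp (v + y)) =
    gram_sum n (cutexp z) (cutexp y) + gram_sum n a (cutexp y) + gram_sum n (cutexp z) a' +
      gram_sum n a a'
    + gram_sum n (fun x => cutexp z x + a x) (cutexp_rem M y v) + gram_sum n (cutexp_rem M z w)
      (cutexp (v + y)).
  have -> : cutexp (w + z) = (fun x => (cutexp z x + a x) + cutexp_rem M z w x).
    by apply/funext => x; rewrite cutexp_shift.
  rewrite gram_sumDl //; congr (_ + _).
  have -> : cutexp (v + y) = (fun x => (cutexp y x + a' x) + cutexp_rem M y v x).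
    by apply/funext => x; rewrite cutexp_shift.
  rewrite gram_sumDr //; last by apply: L2D => //; exact: L2_cutexp.
  congr (_ + _); rewrite gram_sumDr //; last exact: L2_cutexp.
  rewrite !gram_sumDl //; [|exact: L2_cutexp..].
  by rewrite -!addrA; congr (_ + _); rewrite addrCA.
rewrite [X in cnorm X](_ : _ = gram_sum n a a' + gram_sum n (fun x => cutexp z x + a x)
  (cutexp_rem M y v)
   + gram_sum n (cutexp_rem M z w) (cutexp (v + y))); last first.
  rewrite E1 -/a -/a'; move: (gram_sum n (cutexp z) (cutexp y)) (gram_sum n a (cutexp y))
    (gram_sum n (cutexp z) a') => g1 g2 g3.
  by ring.
apply: le_trans (cnormD _ _) _; apply: le_trans (lerD (cnormD _ _) (lexx _)) _.
have m20 : 0 < m ^+ 2 by rewrite exprn_gt0.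
have B1 := gram_sum_le bessel n ltr01 La La'.
have iv0 : 0 < (m ^+ 2)^-1 by rewrite invr_gt0.
have B2 := gram_sum_le bessel n iv0 Lza Lr'.
have B3 := gram_sum_le bessel n m20 Lr (L2_cutexp (v + y)).
have C1 : (nrm2 mu a / 1 + 1 * nrm2 mu a') / 2 <= E * kappa ^+ 2 * m ^+ 2.
  by move: Na Na'; rewrite divr1 mul1r exprMn; set k := kappa; nra.
have C2 : (nrm2 mu (fun x => cutexp z x + a x) / (m ^+ 2)^-1 + (m ^+ 2)^-1 * nrm2 mu (cutexp_rem
  M y v)) / 2
    <= (4 * E + 100 * E * kappa ^+ 4) / 2 * m ^+ 2.
  rewrite invrK.
  have h1 := ler_wpM2r (ltW m20) Nza.
  have h2 : (m ^+ 2)^-1 * nrm2 mu (cutexp_rem M y v) <= 100 * E * kappa ^+ 4 * m ^+ 2.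
    rewrite ler_pdivrMl //; apply: le_trans Nr' _.
    by rewrite [X in X <= _](_ : _ = m ^+ 2 * (100 * E * kappa ^+ 4 * m ^+ 2)) //; ring.
  by move: h1 h2; set k := kappa; lra.
have C3 : (nrm2 mu (cutexp_rem M z w) / m ^+ 2 + m ^+ 2 * nrm2 mu (cutexp (v + y))) / 2
    <= (100 * E * kappa ^+ 4 + E) / 2 * m ^+ 2.
  have h1 := ler_wpM2l (ltW m20) Nvy.
  have h2 : nrm2 mu (cutexp_rem M z w) / m ^+ 2 <= 100 * E * kappa ^+ 4 * m ^+ 2.
    rewrite ler_pdivrMr //; apply: le_trans Nr _.
    by rewrite [X in X <= _](_ : _ = 100 * E * kappa ^+ 4 * m ^+ 2 * m ^+ 2) //; ring.
  by move: h1 h2; set k := kappa; lra.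
move: (le_trans B1 C1) (le_trans B2 C2) (le_trans B3 C3); set k := kappa; lra.
Qed.

(** Conjugating the second frequency undoes the conjugate-linearity of the second argument, which
    makes the function holomorphic; for real [z] it is the diagonal value. *)
Definition hlim (z : 'cV[complex R]_d) : (complex R)^o := gram_lim (cutexp z) (cutexp (map_mx
  Num.conj z)).

Lemma hlim_entire z : differentiable hlim z.
Proof.
pose zc := map_mx Num.conj z.
pose c j : complex R := gram_lim (cutexp_der M z j) (cutexp zc) + gram_lim (cutexp z)
  (cutexp_der M zc j).
have k0 := @kappa_ge0 R M M0.
(* Makes [kappa * e <= 1 / 2], the range needed by the remainder estimate; the added 1 covers
   [kappa = 0]. *)
pose e : R := (2 * (kappa + 1))^-1.
have e0 : 0 < e by rewrite invr_gt0 mulr_gt0 // ltr_wpDl.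
have ke : kappa * e <= 2^-1.
  rewrite /e invfM mulrCA ler_piMr // ler_pdivrMr ?mul1r ?lerDl //.
  by rewrite ltr_wpDl.
pose m0 := \sum_j cnorm (z j 0).
have hm0 j : cnorm (z j 0) <= m0.
  by rewrite /m0 (bigD1 j) //= lerDl sumr_ge0 // => *; exact: cnorm_ge0.
have m00 : 0 <= m0 by apply: sumr_ge0 => *; exact: cnorm_ge0.
(* Bounds the exponentials at all frequencies with coordinates at most [e + m0]: at [z], at its
   conjugate, and at the shifts of the latter by less than [e]. *)
pose E := expR (kappa * (e + m0)) ^+ 2.
have E0 : 0 <= E by exact: sqr_ge0.
pose C := E * kappa ^+ 2 + (100 * E * kappa ^+ 4 + E) / 2 + (4 * E + 100 * E * kappa ^+ 4) / 2.
have C0 : 0 <= C.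
  have := mulr_ge0 E0 (exprn_ge0 2 k0); have := mulr_ge0 E0 (exprn_ge0 4 k0).
  by rewrite /C; set k := kappa; nra.
have hE (y : 'cV[complex R]_d) : (forall j, cnorm (y j 0) <= e + m0) -> forall x, cabs2 (cutexp
  y x) <= E.
  by move=> hy x; apply: cabs2_cutexp_le => //; rewrite addr_ge0 // ltW.
apply: (@differentiable_quadratic _ _ _ hlim (linform c) z (((C + 1)%:C)%C) ((e%:C)%C)).
- exact: linform_continuous.
- by rewrite ltcR ltr_wpDl.
- by rewrite ltcR.
move=> w we; pose m := complex.Re `|w|.
have wm : `|w| = ((m%:C)%C).
  have : 0 <= `|w| by exact: normr_ge0.
  by rewrite lecE /= /m => /andP[/eqP w1 _]; apply: complex_eqP.
have mE : 0 <= m by rewrite -lecR -wm normr_ge0.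
have me : m < e by rewrite -ltcR -wm.
have hw j : cnorm (w j 0) <= m by rewrite -lecR -cnormE -wm; exact: ler_coord_mx_norm.
(* The estimate uses powers of [m] as weights and hence needs [0 < m]. *)
have [m_eq0|m_neq0] := eqVneq m 0.
  have -> : w = 0 by apply/eqP; rewrite -normr_eq0 wm m_eq0.
  by rewrite add0r subrr linear0 subr0 !normr0 expr0n /= mulr0.
have mgt0 : 0 < m by rewrite lt_def m_neq0.
pose wc := map_mx Num.conj w.
have hwc j : cnorm (wc j 0) <= m by rewrite mxE cnormJ.
have hzc j : cnorm (zc j 0) <= m0 by rewrite mxE cnormJ.
rewrite wm -rmorphXn -rmorphM /= cnormE lecR.
apply: (@le_trans _ _ (C * m ^+ 2)); last by rewrite ler_wpM2r ?sqr_ge0 // lerDl.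
apply: (@ccvg_cnorm_le R (fun n => gram_sum n (cutexp (w + z)) (cutexp (wc + zc)) - gram_sum n
  (cutexp z) (cutexp zc)
      - (gram_sum n (fun x => lin w x * cutexp z x) (cutexp zc) + gram_sum n (cutexp z) (fun x
        => lin wc x * cutexp zc x)))).
- by rewrite mulr_ge0 // sqr_ge0.
- have hN (u : nat -> complex R) l : ccvg u l -> ccvg (fun n => - u n) (- l).
    by move=> /(ccvgZ (-1)); rewrite mulN1r; under eq_fun do rewrite mulN1r.
  apply: ccvgD; first apply: ccvgD.
  + rewrite /hlim (_ : map_mx Num.conj (w + z) = wc + zc); last first.
      by apply/matrixP => i j; rewrite !mxE rmorphD.
    by apply: gram_sum_cvg => //; exact: L2_cutexp.
  + by apply: hN; apply: gram_sum_cvg => //; exact: L2_cutexp.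
  + apply: hN.
    rewrite [X in ccvg X _](_ : _ = (fun n => \sum_j w j 0 *
         (gram_sum n (cutexp_der M z j) (cutexp zc) + gram_sum n (cutexp z) (cutexp_der M zc
           j)))); last first.
      apply/funext => n.
      have -> : (fun x => lin w x * cutexp z x) = (fun x => \sum_j w j 0 * cutexp_der M z j x).
        by apply/funext => x; rewrite lin_mul_cutexp.
      have -> : (fun x => lin wc x * cutexp zc x) = (fun x => \sum_j Num.conj (w j 0) *
        cutexp_der M zc j x).
        by apply/funext => x; rewrite lin_mul_cutexp; apply: eq_bigr => j _; rewrite mxE.
      rewrite gram_sum_suml //; last by move=> j; exact: L2_cutexp_der.
      rewrite gram_sum_sumr //; last by move=> j; exact: L2_cutexp_der.
      by rewrite -big_split /=; apply: eq_bigr => j _; rewrite mulrDr.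
    apply: ccvg_sum => j; apply: ccvgZ; apply: ccvgD; apply: gram_sum_cvg => //;
      solve [exact: L2_cutexp_der | exact: L2_cutexp].
- move=> n; apply: gram_sum_remainder => //.
  + by apply: le_trans ke; rewrite ler_wpM2l // ltW.
  + by apply: hE => j; apply: le_trans (hm0 j) _; rewrite lerDr ltW.
  + by apply: hE => j; apply: le_trans (hzc j) _; rewrite lerDr ltW.
  + apply: hE => j; rewrite mxE; apply: le_trans (cnormD _ _) _.
    by apply: lerD => //; apply: le_trans (hwc j) _; exact: ltW.
Qed.
End entire.

(** * The Parseval defect *)

Section defect.
Variables (R : realType) (d : nat) (mu : probability (Rd R d) R).
Variables (I : eqType) (ws : nat -> seq I) (F : I -> 'cV[R]_d -> complex R).
Hypothesis FL2 : forall w, L2 mu (F w).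
Hypothesis bessel : forall n v, L2 mu v -> bessel_sum mu ws F n v <= nrm2 mu v.
Hypothesis bessel_sum_nd : forall v, L2 mu v -> nondecreasing_seq ((bessel_sum mu ws F) ^~ v).
Implicit Types (u v g : 'cV[R]_d -> complex R) (phi psi : 'cV[R]_d -> R).

Definition defect v : R := nrm2 mu v - bessel_lim mu ws F v.

Lemma defect_ge0 v : L2 mu v -> 0 <= defect v.
Proof. by move=> hv; rewrite subr_ge0; exact: bessel_lim_le. Qed.

Lemma defect_le v : L2 mu v -> defect v <= nrm2 mu v.
Proof.
move=> hv; rewrite /defect lerBlDr lerDl.
exact: le_trans (bessel_sum_ge0 _ _ _ 0 _) (bessel_sum_le_lim bessel bessel_sum_nd 0 hv).
Qed.

Lemma bessel_lim_parallelogram u v : L2 mu u -> L2 mu v ->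
  bessel_lim mu ws F (fun x => u x + v x) + bessel_lim mu ws F (fun x => u x + (-1) * v x) = 2 *
    bessel_lim mu ws F u + 2 * bessel_lim mu ws F v.
Proof.
move=> hu hv; have hNv := L2Z (-1) hv; have hp := L2D hu hv; have hm := L2D hu hNv.
have c1 : (bessel_sum mu ws F n (fun x => u x + v x) + bessel_sum mu ws F n (fun x => u x + (-1)
  * v x)) @[n --> \oo] -->
    bessel_lim mu ws F (fun x => u x + v x) + bessel_lim mu ws F (fun x => u x + (-1) * v x) by
      apply: cvgD; exact: bessel_sum_cvg.
have c2 : (2 * bessel_sum mu ws F n u + 2 * bessel_sum mu ws F n v) @[n --> \oo] --> 2 *
  bessel_lim mu ws F u + 2 * bessel_lim mu ws F v.
  by apply: cvgD; apply: cvgM; solve [exact: cvg_cst|exact: bessel_sum_cvg].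
move: c1; under eq_fun => n.
  rewrite (_ : _ + _ = 2 * bessel_sum mu ws F n u + 2 * bessel_sum mu ws F n v); last first.
    rewrite /bessel_sum !mulr_sumr -!big_split /=.
    apply: eq_bigr => w _; rewrite !innerD // innerZ //.
    by move: (inner mu u _) (inner mu v _) => [a b] [a' b']; rewrite /cabs2 /=; ring.
  over.
by move=> c1; exact: (cvg_unique _ c1 c2).
Qed.

Lemma nrm2_parallelogram u v : L2 mu u -> L2 mu v ->
  nrm2 mu (fun x => u x + v x) + nrm2 mu (fun x => u x + (-1) * v x) = 2 * nrm2 mu u + 2 * nrm2
    mu v.
Proof.
move=> hu hv; have hNv := L2Z (-1) hv.
rewrite !nrm2D // innerZr // nrm2Z //.
have -> : cabs2 (-1 : complex R) = 1 by rewrite /cabs2 /= oppr0 expr0n addr0 sqrrN expr1n.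
have -> : complex.Re (Num.conj (-1) * inner mu u v) = - complex.Re (inner mu u v).
  by case: (inner mu u v) => a b /=; ring.
ring.
Qed.

(** The defect obeys the parallelogram law; dropping the nonnegative defect of [u - v] leaves this
    substitute for the triangle inequality. *)
Lemma defectD u v : L2 mu u -> L2 mu v ->
  defect (fun x => u x + v x) <= 2 * defect u + 2 * defect v.
Proof.
move=> hu hv; have hm := L2D hu (L2Z (-1) hv).
have := bessel_lim_parallelogram hu hv; have := nrm2_parallelogram hu hv.
have := defect_ge0 hm; rewrite /defect; lra.
Qed.

Lemma bessel_limZ (c : complex R) v : L2 mu v -> bessel_lim mu ws F (fun x => c * v x) = cabs2 c
  * bessel_lim mu ws F v.
Proof.
move=> hv; have c1 := bessel_sum_cvg bessel bessel_sum_nd (L2Z c hv).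
have c2 : cabs2 c * bessel_sum mu ws F n v @[n --> \oo] --> cabs2 c * bessel_lim mu ws F v.
  by apply: cvgM; [exact: cvg_cst|exact: bessel_sum_cvg].
move: c1; under eq_fun => n.
  rewrite (_ : bessel_sum mu ws F n _ = cabs2 c * bessel_sum mu ws F n v); last first.
    by rewrite /bessel_sum mulr_sumr; apply: eq_bigr => w _; rewrite innerZ // cabs2M.
  over.
by move=> c1; exact: (cvg_unique _ c1 c2).
Qed.

Definition parseval_at v := L2 mu v /\ defect v = 0.

Lemma parseval_atD u v : parseval_at u -> parseval_at v -> parseval_at (fun x => u x + v x).
Proof.
move=> [hu du] [hv dv]; have huv := L2D hu hv; split => //.
by apply/eqP; rewrite eq_le defect_ge0 // andbT; have := defectD hu hv; rewrite du dv; lra.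
Qed.

Lemma parseval_atZ (c : complex R) v : parseval_at v -> parseval_at (fun x => c * v x).
Proof.
move=> [hv dv]; split; first exact: L2Z.
by move: dv; rewrite /defect nrm2Z // bessel_limZ // -mulrBr => ->; rewrite mulr0.
Qed.

(** Dominated convergence, with bound [4 h], sends [nrm2] of [v - u n] to 0; by [defectD] the defect
    of [v] is at most twice this, since [u n] has none. Dominated pointwise limits, rather than
    limits in norm, are what the density argument produces. *)
Lemma parseval_at_lim (u : nat -> 'cV[R]_d -> complex R) v (h : Rd R d -> R) :
  (forall n, parseval_at (u n)) -> (forall x, ccvg (fun n => u n x) (v x)) ->
  mu.-integrable setT (EFin \o h) -> (forall n x, cabs2 (u n x) <= h x) -> parseval_at v.
Proof.
move=> hu uv ih uh.
have mv : cmeas v.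
  split.
    apply: (@measurable_fun_cvg _ _ _ _ (fun n (x : Rd R d) => complex.Re (u n x))).
      by move=> n; have [/L2_cmeas[]] := hu n.
    by move=> x _; have [] := uv x.
  apply: (@measurable_fun_cvg _ _ _ _ (fun n (x : Rd R d) => complex.Im (u n x))).
    by move=> n; have [/L2_cmeas[]] := hu n.
  by move=> x _; have [] := uv x.
have h0 x : 0 <= h x by exact: le_trans (cabs2_ge0 _) (uh 0%N x).
have vh x : cabs2 (v x) <= h x.
  rewrite -(sqr_sqrtr (h0 x)) -cnorm_le ?sqrtr_ge0 //.
  apply: (ccvg_cnorm_le (sqrtr_ge0 _) (uv x)) => n.
  by rewrite cnorm_le ?sqrtr_ge0 // sqr_sqrtr.
have hv : L2 mu v := L2_dominated mv ih vh.
split => //; apply/eqP; rewrite eq_le defect_ge0 // andbT.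
pose e n (x : 'cV[R]_d) : complex R := v x + (-1) * u n x.
have he n : L2 mu (e n) by apply: L2D => //; apply: L2Z; have [] := hu n.
have ne : nrm2 mu (e n) @[n --> \oo] --> (0 : R).
  have ih4 : mu.-integrable setT (EFin \o (fun x => 4 * h x)) by exact: integrableZl'.
  have [|||||_ _] := @dominated_convergence _ _ _ mu setT measurableT
      (fun n => EFin \o (fun x => cabs2 (e n x))) (cst 0%E) (EFin \o (fun x => 4 * h x)).
  - by move=> n; apply/measurable_EFinP; apply: measurable_cabs2; exact: L2_cmeas.
  - exact: measurable_cst.
  - apply: aeW => x _ /=; apply: cvg_EFin; first by apply: nearW.
    have [u1 u2] := ccvgD (uv x) (ccvgZ (-1) (uv x)).
    rewrite /comp /=.
    have [e1 e2] : ccvg (fun n => e n x) (v x + (-1) * v x).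
      by apply: ccvgD; [split; exact: cvg_cst|apply: ccvgZ; exact: uv].
    have -> : (0 : R) = cabs2 (v x + -1 * v x) by rewrite mulN1r subrr cabs2_0.
    by apply: cvgD; rewrite expr2; under eq_fun do rewrite expr2; exact: cvgM.
  - exact: ih4.
  - apply: aeW => x n _ /=; rewrite lee_fin ger0_norm ?cabs2_ge0 //.
    apply: le_trans (cabs2D_le _ _) _; rewrite cabs2M.
    have -> : cabs2 (-1 : complex R) = 1 by rewrite /cabs2 /= oppr0 expr0n addr0 sqrrN expr1n.
    by have := vh x; have := uh n x; lra.
  rewrite integral_cst // mul0e => /fine_cvgP [_]; apply: cvg_trans.
  by apply: near_eq_cvg; apply: nearW => n.
have c2 : 2 * nrm2 mu (e n) @[n --> \oo] --> (0 : R).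
  by rewrite -[0](mulr0 2); apply: cvgM; [exact: cvg_cst|exact: ne].
apply: (cvgr_to_ge c2); apply: nearW => n.
have := defectD (he n) (proj1 (hu n)); have := defect_le (he n); rewrite (proj2 (hu n)).
have -> : (fun x => e n x + u n x) = v by apply/funext => x; rewrite /e mulN1r subrK.
rewrite /= => *; lra.
Qed.
End defect.

(** * Density of the trigonometric polynomials *)

Section sign_iteration.
Variable R : realType.

(** Newton's step for [s^(-2) = 1]. It is a polynomial, so an algebra of functions is stable under
    it, and its iterates on [[-1, 1]] tend to the sign. *)
Definition sgstep (s : R) : R := (3 * s - s ^+ 3) / 2.

Lemma sgstep_itv s : `|s| <= 1 -> `|sgstep s| <= 1.
Proof.
rewrite !ler_norml /sgstep => /andP[s1 s2].
(* The two products are [2 (1 - sgstep s)] and [2 (1 + sgstep s)]. *)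
have h1 : 0 <= (1 - s) ^+ 2 * (2 + s) by rewrite mulr_ge0 ?sqr_ge0 //; lra.
have h2 : 0 <= (1 + s) ^+ 2 * (2 - s) by rewrite mulr_ge0 ?sqr_ge0 //; lra.
by rewrite !exprS expr0 in h1 h2 *; apply/andP; split; lra.
Qed.

Lemma sgstepN s : sgstep (- s) = - sgstep s.
Proof. by rewrite /sgstep; ring. Qed.

Lemma iter_sgstepN n s : iter n sgstep (- s) = - iter n sgstep s.
Proof. by elim: n => //= n ->; rewrite sgstepN. Qed.

Lemma iter_sgstep_itv n s : `|s| <= 1 -> `|iter n sgstep s| <= 1.
Proof. by move=> h; elim: n => //= n; exact: sgstep_itv. Qed.

(* [1 - sgstep s = (1 - s) (1 - s / 2 - s ^ 2 / 2)], so that the distance to 1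
   contracts by [1 - s / 2] and the iterates of a positive start increase. *)
Lemma iter_sgstep_pos n s : 0 < s -> s <= 1 ->
  s <= iter n sgstep s <= 1 /\ 1 - iter n sgstep s <= (1 - s / 2) ^+ n.
Proof.
move=> s0 s1; elim: n => [|n [/andP[h1 h2] h3]] /=.
  by rewrite lexx s1 expr0; split => //; lra.
set t := iter n sgstep s in h1 h2 h3 *.
have E : 1 - sgstep t = (1 - t) * (1 - t / 2 - t ^+ 2 / 2) by rewrite /sgstep; field.
have q0 : 0 <= (1 - s / 2) ^+ n by rewrite exprn_ge0 //; lra.
have h4 : t <= sgstep t.
  rewrite -subr_ge0 (_ : sgstep t - t = t * (1 - t) * (1 + t) / 2); last by rewrite /sgstep;
    field.
  by rewrite divr_ge0 // !mulr_ge0 //; lra.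
have : `|sgstep t| <= 1 by apply: sgstep_itv; rewrite ger0_norm; lra.
rewrite ler_norml => /andP[_ h5].
split; first by rewrite (le_trans h1 h4).
have a1 : 1 - t / 2 - t ^+ 2 / 2 <= 1 - s / 2 by have := sqr_ge0 t; lra.
rewrite E [leRHS]exprSr; apply: le_trans (ler_wpM2l _ a1) _; first lra.
by apply: ler_wpM2r => //; lra.
Qed.

Lemma cvg_iter_sgstep s : `|s| <= 1 -> iter n sgstep s @[n --> \oo] --> Num.sg s.
Proof.
wlog s0 : s / 0 <= s => [h hs|].
  have [/h|/ltW s0] := leP 0 s; first exact.
  have : - iter n sgstep (- s) @[n --> \oo] --> - Num.sg (- s).
    by apply: cvgN; apply: h; rewrite ?oppr_ge0 ?normrN.
  by rewrite sgrN opprK; under eq_fun do rewrite iter_sgstepN opprK.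
rewrite ger0_norm // => s1; move: s0; rewrite le_eqVlt => /orP[/eqP<-|s0].
  rewrite sgr0; apply: cvg_near_cst; apply: nearW => n.
  by elim: n => //= n ->; rewrite /sgstep; field.
rewrite gtr0_sg //.
have hq : `|1 - s / 2| < 1 by rewrite ltr_norml; lra.
have hz : 1 - (1 - s / 2) ^+ n @[n --> \oo] --> (1 : R).
  rewrite -[X in _ --> X]subr0; apply: cvgB; first exact: cvg_cst.
  exact: cvg_expr.
apply: (squeeze_cvgr _ hz (cvg_cst (1 : R))); apply: nearW => n.
have [/andP[_ h1] h2] := iter_sgstep_pos n s0 s1.
by rewrite h1 andbT; lra.
Qed.
End sign_iteration.

Section density.
Variables (R : realType) (d : nat) (mu : probability (Rd R d) R).
Variable V : ('cV[R]_d -> complex R) -> Prop.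
Implicit Types (f g u v : 'cV[R]_d -> complex R) (phi psi : 'cV[R]_d -> R).
Hypothesis V_add : forall u v, V u -> V v -> V (fun x => u x + v x).
Hypothesis V_scale : forall (c : complex R) v, V v -> V (fun x => c * v x).
Hypothesis V_lim : forall (u : nat -> 'cV[R]_d -> complex R) v (h : Rd R d -> R),
  (forall n, V (u n)) -> (forall x, ccvg (fun n => u n x) (v x)) ->
  mu.-integrable setT (EFin \o h) -> (forall n x, cabs2 (u n x) <= h x) -> V v.
Hypothesis V_e2pi : forall t, V (fun x => e2pi (dot t x)).

Definition cbounded g := exists C : R, forall x, cabs2 (g x) <= C.

Definition modulable g := cbounded g /\ forall t, V (fun x => g x * e2pi (dot t x)).

(** [V] need not be closed under products, whereas the multipliers of the modulable functions form
    an algebra by construction. It contains the exponentials, which only shift the frequency [t],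
    and is closed under bounded pointwise limits. *)
Definition multiplier f := cbounded f /\ forall g, modulable g -> modulable (fun x => f x * g x).

Lemma cboundedD f g : cbounded f -> cbounded g -> cbounded (fun x => f x + g x).
Proof.
move=> [C hC] [D hD]; exists (2 * C + 2 * D) => x.
apply: le_trans (cabs2D_le _ _) _; have := hC x; have := hD x; lra.
Qed.

Lemma cboundedM f g : cbounded f -> cbounded g -> cbounded (fun x => f x * g x).
Proof.
move=> [C hC] [D hD]; exists (C * D) => x; rewrite cabs2M.
by apply: ler_pM => //; exact: cabs2_ge0.
Qed.

Lemma cbounded_cst (c : complex R) : cbounded (fun=> c).
Proof. by exists (cabs2 c). Qed.

Lemma cabs2_lim_le (a : nat -> complex R) (l : complex R) (C : R) :
  ccvg a l -> (forall n, cabs2 (a n) <= C) -> cabs2 l <= C.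
Proof.
move=> al h; have C0 : 0 <= C := le_trans (cabs2_ge0 _) (h 0%N).
rewrite -(sqr_sqrtr C0) -cnorm_le ?sqrtr_ge0 //; apply: (ccvg_cnorm_le (sqrtr_ge0 _) al) => n.
by rewrite cnorm_le ?sqrtr_ge0 // sqr_sqrtr.
Qed.

Lemma modulable_cst1 : modulable (fun=> 1).
Proof.
split; first exact: cbounded_cst.
by move=> t; under eq_fun do rewrite mul1r.
Qed.

Lemma modulable_lim (g : nat -> 'cV[R]_d -> complex R) f (C : R) : (forall n, modulable (g n)) ->
  (forall x, ccvg (fun n => g n x) (f x)) -> (forall n x, cabs2 (g n x) <= C) -> modulable f.
Proof.
move=> hg gf gC; split; first by exists C => x; exact: cabs2_lim_le (gf x) _.
move=> t; apply: (V_lim (u := fun n x => g n x * e2pi (dot t x)) (h := fun=> C)).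
- by move=> n; have [_] := hg n.
- move=> x; rewrite mulrC; under eq_fun do rewrite mulrC; exact: ccvgZ.
- exact: integrable_cst.
- by move=> n x; rewrite cabs2M cabs2_e2pi mulr1.
Qed.

Lemma multiplier_lim (f_ : nat -> 'cV[R]_d -> complex R) f (C : R) :
  (forall n, multiplier (f_ n)) -> (forall x, ccvg (fun n => f_ n x) (f x)) ->
  (forall n x, cabs2 (f_ n x) <= C) -> multiplier f.
Proof.
move=> hf cf fC; split; first by exists C => x; exact: cabs2_lim_le (cf x) _.
move=> g Wg; have [[D hD] _] := Wg.
apply: (modulable_lim (g := fun n x => f_ n x * g x) (C := C * D)).
- by move=> n; have [_] := hf n; apply.
- move=> x; rewrite mulrC; under eq_fun do rewrite mulrC; exact: ccvgZ.
- by move=> n x; rewrite cabs2M; apply: ler_pM => //; exact: cabs2_ge0.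
Qed.

Lemma multiplier_cst (c : complex R) : multiplier (fun=> c).
Proof.
split; first exact: cbounded_cst.
move=> g [bg Vg]; split; first by apply: cboundedM => //; exact: cbounded_cst.
by move=> t; under eq_fun do rewrite -mulrA; exact: V_scale.
Qed.

Lemma multiplierD f g : multiplier f -> multiplier g -> multiplier (fun x => f x + g x).
Proof.
move=> [bf hf] [bg hg]; split; first exact: cboundedD.
move=> u Wu; have [b1 V1] := hf _ Wu; have [b2 V2] := hg _ Wu; split.
  by under eq_fun do rewrite mulrDl; exact: cboundedD.
by move=> t; under eq_fun do rewrite !mulrDl; exact: V_add.
Qed.

Lemma multiplierM f g : multiplier f -> multiplier g -> multiplier (fun x => f x * g x).
Proof.
move=> [bf hf] [bg hg]; split; first exact: cboundedM.
by move=> u Wu; under eq_fun do rewrite -mulrA; apply: hf; exact: hg.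
Qed.

Lemma multiplier_e2pi t : multiplier (fun x => e2pi (dot t x)).
Proof.
have bt : cbounded (fun x => e2pi (dot t x)) by exists 1 => x; rewrite cabs2_e2pi.
split => // g [bg Vg]; split; first exact: cboundedM.
move=> s; under eq_fun => x do rewrite mulrAC -e2piD -dotDl mulrC.
exact: Vg.
Qed.

Definition rmultiplier phi := multiplier (fun x => ((phi x)%:C)%C).

Lemma rmultiplierD phi psi : rmultiplier phi -> rmultiplier psi ->
  rmultiplier (fun x => phi x + psi x).
Proof. by rewrite /rmultiplier; under [X in _ -> _ -> multiplier X]eq_fun do rewrite rmorphD;
  exact: multiplierD. Qed.

Lemma rmultiplierM phi psi : rmultiplier phi -> rmultiplier psi ->
  rmultiplier (fun x => phi x * psi x).
Proof. by rewrite /rmultiplier; under [X in _ -> _ -> multiplier X]eq_fun do rewrite rmorphM;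
  exact: multiplierM. Qed.

Lemma rmultiplier_cst (c : R) : rmultiplier (fun=> c).
Proof. exact: multiplier_cst. Qed.

Lemma rmultiplier_lim (phi_ : nat -> 'cV[R]_d -> R) phi (C : R) :
  (forall n, rmultiplier (phi_ n)) -> (forall x, phi_ n x @[n --> \oo] --> phi x) ->
  (forall n x, `|phi_ n x| <= C) -> rmultiplier phi.
Proof.
move=> hf cf fC; apply: (multiplier_lim (f_ := fun n x => ((phi_ n x)%:C)%C) (C := C ^+ 2)) => //.
  by move=> x; split => /=; [exact: cf|exact: cvg_cst].
move=> n x; rewrite cabs2_real -real_normK ?num_real //.
by rewrite ler_sqr ?nnegrE // (le_trans _ (fC n x)).
Qed.

Lemma rmultiplier_iter_sgstep n phi : rmultiplier phi ->
  rmultiplier (fun x => iter n (@sgstep R) (phi x)).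
Proof.
move=> hphi; elim: n => //= n IH.
set psi := fun x => iter n _ _ in IH.
have -> : (fun x => sgstep (iter n (@sgstep R) (phi x))) =
   (fun x => (3 / 2) * psi x + (- (1 / 2)) * (psi x * (psi x * psi x))).
  by apply/funext => x; rewrite /sgstep -/(psi x); field.
apply: rmultiplierD; (apply: rmultiplierM; first exact: rmultiplier_cst); first exact: IH.
by apply: rmultiplierM => //; exact: rmultiplierM.
Qed.

Lemma rmultiplier_sg phi : rmultiplier phi -> (forall x, `|phi x| <= 1) ->
  rmultiplier (fun x => Num.sg (phi x)).
Proof.
move=> hphi h; apply: (rmultiplier_lim (phi_ := fun n x => iter n (@sgstep R) (phi x)) (C := 1)).
- by move=> n; exact: rmultiplier_iter_sgstep.
- by move=> x; exact: cvg_iter_sgstep.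
- by move=> n x; exact: iter_sgstep_itv.
Qed.

Lemma rmultiplier_sin t (a : R) : rmultiplier (fun x => sin (2 * pi * (dot t x - a))).
Proof.
rewrite /rmultiplier.
have -> : (fun x => ((sin (2 * pi * (dot t x - a)))%:C)%C) =
  (fun x => ((0 -i* 2^-1)%C * e2pi (- a)) * e2pi (dot t x) +
            ((0 +i* 2^-1)%C * e2pi a) * e2pi (dot (- t) x)).
  apply/funext => x; rewrite -(mulrA _ (e2pi (- a))) -(mulrA _ (e2pi a)) -!e2piD dotNl.
  have E1 : - a + dot t x = dot t x - a by ring.
  have E2 : a - dot t x = - (dot t x - a) by ring.
  rewrite E1 E2 e2piN /e2pi; move: (2 * pi * _) => y.
  by apply: complex_eqP; rewrite !(cReD, cImD, cReM, cImM, cReJ, cImJ) /=; field.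
exact: (multiplierD (multiplierM (multiplier_cst _) (multiplier_e2pi t))
                    (multiplierM (multiplier_cst _) (multiplier_e2pi (- t)))).
Qed.

(** The sine of [2 pi 2^(-k) (x_i - a)] is a multiplier, and it has the sign of [x_i - a] as soon as
    [2 |x_i - a| 2^(-k) < 1], its argument then being within [pi] of 0. Its sign is thus eventually
    constant in [k] at each point. *)
Lemma rmultiplier_sg_coord i (a : R) : rmultiplier (fun x => Num.sg (x i 0 - a)).
Proof.
pose t k : 'cV[R]_d := \col_j (if j == i then 2^-1 ^+ k else 0).
have dt k x : dot (t k) x = 2^-1 ^+ k * x i 0.
  rewrite /dot (bigD1 i) //= big1 ?addr0 ?mxE ?eqxx // => j ji.
  by rewrite mxE (negPf ji) mul0r.
apply: (rmultiplier_lim (phi_ := fun k x => Num.sg (sin (2 * pi * (dot (t k) x - 2^-1 ^+ k *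
  a)))) (C := 1)).
- move=> n; apply: rmultiplier_sg; first exact: rmultiplier_sin.
  by move=> x; rewrite ler_norml sin_geN1 sin_le1.
- move=> x; apply: cvg_near_cst.
  have hq : `|2^-1 : R| < 1 by rewrite ger0_norm //; lra.
  have := cvg_geometric (2 * `|x i 0 - a|) hq.
  move=> /cvgrPdist_lt /(_ 1 ltr01); apply: filterS => k /=.
  rewrite sub0r normrN /geometric /= dt -mulrBr.
  set q := 2^-1 ^+ k; set y := x i 0 - a.
  have q0 : 0 < q by rewrite exprn_gt0 // invr_gt0.
  have hpos (w : R) : 0 < w -> `|2 * `|w| * q| < 1 -> Num.sg (sin (2 * pi * (q * w))) = Num.sg w.
    move=> w0; rewrite ger0_norm; last by rewrite !mulr_ge0 // ltW.
    rewrite (gtr0_norm w0) => hw; rewrite (gtr0_sg w0) gtr0_sg //.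
    apply: sin_gt0_pi; have p0 := pi_gt0 R; have qw : 0 < q * w by rewrite mulr_gt0.
    apply/andP; split; first by rewrite !mulr_gt0.
    rewrite (_ : 2 * pi * (q * w) = pi * (2 * w * q)); last by ring.
    by rewrite -[ltRHS]mulr1 ltr_pM2l.
  have [y0|y0|->] := ltgtP y 0; last by rewrite !mulr0 sin0 sgr0.
    move=> h; have := hpos (- y); rewrite oppr_gt0 normrN !mulrN sinN !sgrN => /(_ y0 h).
    by move/oppr_inj.
  exact: hpos.
- move=> n x; rewrite normr_sg; case: (_ != _) => //=.
Qed.

Lemma sgr_indic (y : R) : (Num.sg y * Num.sg y + Num.sg y) / 2 = ((0 < y)%R : nat)%:R.
Proof.
have [y0|y0|->] := ltgtP y 0; last by rewrite sgr0 mulr0 addr0 mul0r.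
  by rewrite ltr0_sg // mulrNN mulr1 subrr mul0r.
by rewrite gtr0_sg // mulr1 -[1 + 1]/(2%:R) divff.
Qed.

Definition indic_mult : set (set 'cV[R]_d) := [set E : set 'cV[R]_d | rmultiplier (fun x => (x
  \in E)%:R)].

(** For a countable union, one minus the product of the [1 - 1_(E k)] over [k < n] is the indicator
    of the union of the first [n] sets: a polynomial in multipliers, eventually constant at each
    point. *)
Lemma indic_mult_sigma_algebra : sigma_algebra setT indic_mult.
Proof.
split => /=.
- rewrite /indic_mult /=; have -> : (fun x : 'cV[R]_d => (x \in set0)%:R) = (fun=> 0 : R).
    by apply/funext => x; rewrite in_set0.
  exact: rmultiplier_cst.
- move=> E hE; rewrite setTD /indic_mult /=.
  have -> : (fun x : 'cV[R]_d => (x \in ~` E)%:R) = (fun x => (1 : R) + (-1) * (x \in E)%:R).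
    by apply/funext => x; rewrite in_setC; case: (x \in E) => /=; ring.
  by apply: rmultiplierD; [|apply: rmultiplierM => //]; exact: rmultiplier_cst.
- move=> E hE; rewrite /indic_mult /=.
  have hp n : rmultiplier (fun x => \prod_(k < n) (1 + (-1) * (x \in E k)%:R)).
    elim: n => [|n IH]; first by under eq_fun do rewrite big_ord0; exact: rmultiplier_cst.
    under eq_fun do rewrite big_ord_recr /=; apply: rmultiplierM => //.
    by apply: rmultiplierD; [|apply: rmultiplierM; [|exact: hE]]; exact: rmultiplier_cst.
  have h01 n (x : 'cV[R]_d) : \prod_(k < n) (1 + (-1) * (x \in E k)%:R) =
      (~~ [exists k : 'I_n, x \in E k])%:R :> R.
    have [/existsP [k xk]|/existsPn h] := boolP [exists k : 'I_n, x \in E k].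
      by rewrite (bigD1 k) //= xk mulN1r subrr mul0r.
    by rewrite big1 // => k _; rewrite (negPf (h k)) mulr0 addr0.
  apply: (rmultiplier_lim (phi_ := fun n x => 1 + (-1) * \prod_(k < n) (1 + (-1) * (x \in E
    k)%:R)) (C := 1)).
  + by move=> n; apply: rmultiplierD; [|apply: rmultiplierM => //]; exact: rmultiplier_cst.
  + move=> x; apply: cvg_near_cst; have [|xE] := boolP (x \in \bigcup_k E k).
      rewrite inE => -[k _ xk]; exists k.+1 => // n /= kn; rewrite h01.
      have -> : [exists k : 'I_n, x \in E k] by apply/existsP; exists (Ordinal kn); rewrite inE.
      by rewrite mulr0 addr0.
    apply: nearW => n; rewrite h01.
    have -> : [exists k : 'I_n, x \in E k] = false.
      apply/existsP => -[k]; rewrite inE => xk; move: xE; rewrite notin_setE; apply.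
      by exists k.
    by rewrite /=; ring.
  + by move=> n x; rewrite h01; case: (~~ _);
    rewrite /= ?mulr1 ?mulr0 ?subrr ?addr0 ?normr0 ?normr1.
Qed.

Lemma V_indic (E : set (Rd R d)) : measurable E -> V (fun x => ((\1_E x)%:C)%C).
Proof.
move=> mE; have : indic_mult E.
  apply: borel_ind mE; first exact: indic_mult_sigma_algebra.
  move=> i a; rewrite /indic_mult /=.
  have -> : (fun x : 'cV[R]_d => (x \in [set x : 'cV[R]_d | a < x i 0])%:R) =
    (fun x => 2^-1 * (Num.sg (x i 0 - a) * Num.sg (x i 0 - a) + Num.sg (x i 0 - a)) : R).
    apply/funext => x; rewrite mulrC sgr_indic subr_gt0; congr (_%:R).
    by apply: congr1; apply/idP/idP; rewrite inE.
  apply: rmultiplierM; first exact: rmultiplier_cst.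
  by apply: rmultiplierD; [apply: rmultiplierM|]; exact: rmultiplier_sg_coord.
(* A multiplier acts on the constant 1, and frequency 0 brings the product back into [V]. *)
move=> [_ /(_ _ modulable_cst1) [_ /(_ 0)]].
congr (V _); apply/funext => x; rewrite dot0l e2pi0 !mulr1.
by rewrite indicE.
Qed.

Lemma V_zero : V (fun=> 0).
Proof. by have := V_scale 0 (V_e2pi 0); under eq_fun do rewrite mul0r. Qed.

Import HBNNSimple.

Lemma V_nonneg (f : Rd R d -> R) : measurable_fun setT f -> (forall x, 0 <= f x) ->
  mu.-integrable setT (EFin \o (fun x => f x ^+ 2)) -> V (fun x => ((f x)%:C)%C).
Proof.
move=> mf f0 if2.
have mEf : measurable_fun setT (EFin \o f) by exact/measurable_EFinP.
pose h := nnsfun_approx measurableT mEf.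
have hcvg x : h n x @[n --> \oo] --> f x.
  have h0 y : [set: Rd R d] y -> (0 <= (EFin \o f) y)%E by move=> _; rewrite lee_fin.
  have /fine_cvgP [_] := cvg_nnsfun_approx measurableT mEf h0 (I : [set: Rd R d] x).
  by apply: cvg_trans; apply: near_eq_cvg; apply: nearW.
have hle n x : h n x <= f x.
  have <- : limn (fun n => h n x) = f x by apply: cvg_lim (hcvg x).
  apply: (nondecreasing_cvgn_le (u_ := fun n => h n x)); last by apply/cvg_ex; exists (f x).
  by move=> m k mk; exact/lefP/nd_nnsfun_approx.
(* [V_lim] bounds squared moduli, so the simple functions below [f] are dominated by [f ^+ 2]. *)
apply: (V_lim (u := fun n x => ((h n x)%:C)%C) (h := fun x => f x ^+ 2)) => //.
- move=> n.
  have -> : (fun x => ((h n x)%:C)%C) = (fun x => \sum_(y <- finmap.enum_fset (fset_set (range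
    (h n))))
      ((y%:C)%C) * (((\1_(h n @^-1` [set y]) x)%:C)%C)).
    apply/funext => x; rewrite {1}(fimfunE (h n)) fsbig_finite //= rmorph_sum /=.
    by apply: eq_bigr => y _; rewrite rmorphM.
  elim: (X in V (fun x => \sum_(y <- X) _)) => [|y s IH].
    by under eq_fun do rewrite big_nil; exact: V_zero.
  under eq_fun do rewrite big_cons; apply: V_add => //; apply: V_scale; apply: V_indic.
  by rewrite -[X in measurable X]setTI; exact: measurable_funP.
- by move=> x; split => /=; [exact: hcvg|exact: cvg_cst].
- by move=> n x; rewrite cabs2_real ler_sqr ?nnegrE.
Qed.

Lemma V_real (f : Rd R d -> R) : measurable_fun setT f ->
  mu.-integrable setT (EFin \o (fun x => f x ^+ 2)) -> V (fun x => ((f x)%:C)%C).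
Proof.
move=> mf if2.
have h (g : Rd R d -> R) : measurable_fun setT g -> (forall x, g x ^+ 2 <= f x ^+ 2) ->
   (forall x, 0 <= g x) -> V (fun x => ((g x)%:C)%C).
  move=> mg gf g0; apply: V_nonneg => //.
  apply: (le_integrable measurableT) if2; first by apply/measurable_EFinP; exact: measurable_funX.
  by move=> x _ /=; rewrite lee_fin !ger0_norm ?sqr_ge0.
have -> : (fun x => ((f x)%:C)%C) =
  (fun x => ((Num.max (f x) 0)%:C)%C + (-1) * ((Num.max (- f x) 0)%:C)%C :> complex R).
  apply/funext => x; have /orP[f0|f0] := le_total 0 (f x).
    have -> : Num.max (f x) 0 = f x by apply/max_idPl.
    have -> : Num.max (- f x) 0 = 0 by apply/max_idPr; rewrite oppr_le0.
    by rewrite mulr0 addr0.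
  have -> : Num.max (f x) 0 = 0 by apply/max_idPr.
  have -> : Num.max (- f x) 0 = - f x by apply/max_idPl; rewrite oppr_ge0.
  by apply: complex_eqP => /=; ring.
apply: V_add; last apply: V_scale; apply: h.
- exact: measurable_maxr.
- by move=> x; case: (leP 0 (f x)) => // _; rewrite ?expr0n ?sqr_ge0.
- by move=> x; rewrite le_max lexx orbT.
- by apply: measurable_maxr => //; exact: measurableT_comp.
- by move=> x; case: (leP 0 (- f x)) => // _; rewrite ?sqrrN ?expr0n ?sqr_ge0.
- by move=> x; rewrite le_max lexx orbT.
Qed.

Lemma trigonometric_dense v : L2 mu v -> V v.
Proof.
move=> hv; have [m1 m2] := L2_cmeas hv; have iv := L2_integrable_cabs2 hv.
have -> : v = (fun x => ((complex.Re (v x))%:C)%C + 'i%C * ((complex.Im (v x))%:C)%C).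
  by apply/funext => x; rewrite -complexE.
apply: V_add; last apply: V_scale; apply: V_real => //.
  apply: (le_integrable measurableT) iv; first by apply/measurable_EFinP; exact: measurable_funX.
  by move=> x _ /=; rewrite lee_fin !ger0_norm ?sqr_ge0 ?cabs2_ge0 // /cabs2 lerDl sqr_ge0.
apply: (le_integrable measurableT) iv; first by apply/measurable_EFinP; exact: measurable_funX.
by move=> x _ /=; rewrite lee_fin !ger0_norm ?sqr_ge0 ?cabs2_ge0 // /cabs2 lerDr sqr_ge0.
Qed.
End density.

(** * Words of Omega and finite sums *)

Section words_Omega.
Variables (d : nat) (L : seq 'cV[int]_d).
Implicit Types w : seq 'cV[int]_d.

(** The representative in [Omega] of a padded word. The tail is stripped first, since a zero is
    dropped only when nothing nonzero follows it. *)
Fixpoint strip w : seq 'cV[int]_d :=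
  if w is l :: w' then
    if (strip w' == [::]) && (l == 0) then [::] else l :: strip w'
  else [::].

Lemma strip_cat_nseq w : strip w ++ nseq (size w - size (strip w)) 0 = w.
Proof.
elim: w => //= l w IH; case: ifPn => [/andP[/eqP s0 /eqP ->]|_] /=; last by rewrite subSS IH.
by move: IH; rewrite s0 /= subn0 => ->.
Qed.

Lemma strip_Omega w : all (fun l => l \in L) w -> Omega L (strip w).
Proof.
elim: w => [|l w IH] /=; first by move=> _; split => //; left.
move=> /andP[lL /IH [h1 h2]]; case: ifPn => [_|]; first by split => //; left.
rewrite negb_and => h; split => /=; first by rewrite lL.
right; case: h2 => [s0|]; first by move: h; rewrite s0.
by case: (strip w) => [|a s] //=; rewrite eqxx.
Qed.

Lemma strip_cat_nseq_id w k : w = [::] \/ last 0 w != 0 -> strip (w ++ nseq k 0) = w.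
Proof.
have s0 : strip (nseq k 0) = [::] by elim: k => //= k ->; rewrite !eqxx.
elim: w => [|l w IH] //= [//|h].
case: w IH h => [|a w] IH h; first by rewrite /= s0 (negPf h) andbF.
by rewrite IH //; right.
Qed.

Lemma mem_words n w : (w \in words L n) = (size w == n) && all (fun l => l \in L) w.
Proof.
elim: n w => [|n IH] [|l w] //=.
- by apply/negbTE/allpairsP => -[[a b] [_ _]].
- apply/allpairsP/idP => [[[a b] /= [aL]]|/andP[/eqP[sw] /andP[lL aw]]].
    by rewrite IH => /andP[/eqP sb ab] [-> ->]; rewrite /= sb eqxx aL.
  by exists (l, w) => /=; split => //; rewrite IH sw eqxx.
Qed.

Lemma uniq_words n : uniq L -> uniq (words L n).
Proof.
move=> uL; elim: n => //= n IH; apply: allpairs_uniq => //.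
by move=> [a b] [a' b'] _ _ /= [-> ->].
Qed.

Lemma uniq_strip_words n : uniq L -> uniq [seq strip w | w <- words L n].
Proof.
move=> uL; rewrite map_inj_in_uniq ?uniq_words // => w w'.
rewrite !mem_words => /andP[/eqP sw _] /andP[/eqP sw' _] h.
by rewrite -(strip_cat_nseq w) -(strip_cat_nseq w') sw sw' h.
Qed.

Lemma Omega_strip_words n w : 0 \in L -> Omega L w -> (size w <= n)%N -> w \in [seq strip w | w
  <- words L n].
Proof.
move=> L0 [aw h] sw; apply/mapP; exists (w ++ nseq (n - size w) 0);
  last by rewrite strip_cat_nseq_id.
rewrite mem_words size_cat size_nseq subnKC // eqxx all_cat aw /=.
by apply/allP => l /nseqP [-> _].
Qed.

(** Stripping matches the words of length [n] with the members of [Omega] of length at most [n],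
    each counted once. Level sums are therefore finite subsums of the unordered sum, and a finite
    subset of [Omega] is contained in the level of its longest word. *)
Lemma esum_Omega (R : realType) (c : seq 'cV[int]_d -> R) (s : R) : uniq L -> 0 \in L ->
  (forall w, 0 <= c w) -> (forall w, c (strip w) = c w) ->
  nondecreasing_seq (fun n => \sum_(w <- words L n) c w) ->
  (\sum_(w <- words L n) c w) @[n --> \oo] --> s ->
  (\esum_(w in Omega L) (c w)%:E = s%:E)%E.
Proof.
move=> uL L0 c0 cs nd cv.
have hle n : \sum_(w <- words L n) c w <= s.
  have <- : limn (fun n => \sum_(w <- words L n) c w) = s by apply: cvg_lim cv.
  by apply: (nondecreasing_cvgn_le nd); apply/cvg_ex; exists s.
have hE n : (\sum_(w \in [set` [seq strip w | w <- words L n]]) (c w)%:E =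
     (\sum_(w <- words L n) c w)%:E)%E.
  rewrite -fsbig_seq ?uniq_strip_words // big_map -sumEFin.
  by apply: eq_bigr => w _; rewrite cs.
apply/eqP; rewrite eq_le; apply/andP; split.
  apply: ub_ereal_sup => _ [X [finX XO] <-].
  have /finite_seqP [r rX] := finX.
  pose n := \max_(w <- r) size w.
  apply: (@le_trans _ _ (\sum_(w \in [set` [seq strip w | w <- words L n]]) (c w)%:E)%E);
    last first.
    by rewrite hE lee_fin.
  apply: lee_fsum_nneg_subset => //; first exact: finite_seq.
  - by move=> w; rewrite !inE => Xw; apply: Omega_strip_words; [exact: L0|exact: XO|];
      apply: leq_bigmax_seq => //; move: Xw; rewrite rX.
  - by move=> w _; rewrite lee_fin.
have cvE : ((\sum_(w <- words L n) c w)%:E @[n --> \oo] --> s%:E)%E by apply: cvg_EFin => //;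
  apply: nearW.
apply: (cvge_to_le cvE); apply: nearW => n; rewrite -hE.
apply: ereal_sup_ubound; exists [set` [seq strip w | w <- words L n]] => //; split;
  first exact: finite_seq.
move=> w /= /mapP [w' w'n ->]; apply: strip_Omega.
by move: w'n; rewrite mem_words => /andP[].
Qed.
End words_Omega.

(** * Null sets, real frequencies and padding *)

Section ae.
Variables (R : realType) (d : nat) (mu : probability (Rd R d) R) (K : set (Rd R d)).
Hypotheses (mK : measurable K) (K1 : mu K = 1%E).

Lemma Rintegral_eq_on (f g : Rd R d -> R) : measurable_fun setT f -> measurable_fun setT g ->
  (forall x, K x -> f x = g x) -> Rintegral mu setT f = Rintegral mu setT g.
Proof.
move=> mf mg fg; rewrite /Rintegral; congr fine; apply: ae_eq_integral => //.
- exact/measurable_EFinP.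
- exact/measurable_EFinP.
exists (~` K); split.
- exact: measurableC.
- by have := probability_setC mu mK; rewrite K1 subee.
- by move=> x /= h Kx; apply: h => _; rewrite fg.
Qed.

Lemma inner_eq_on u v f : cmeas u -> cmeas v -> cmeas f -> (forall x, K x -> u x = v x) ->
  inner mu u f = inner mu v f.
Proof.
move=> mu_ mv mf uv.
have [u1 u2] := cmeasM mu_ (cmeasJ mf); have [v1 v2] := cmeasM mv (cmeasJ mf).
by rewrite /inner /cint; apply: complex_eqP => /=; apply: Rintegral_eq_on => // x Kx; rewrite uv.
Qed.
End ae.

Section real_frequencies.
Variables (R : realType) (d : nat).

Lemma conj_cemb (t : 'cV[R]_d) : map_mx Num.conj (cemb t) = cemb t.
Proof. by apply/matrixP => i j; rewrite !mxE; apply: complex_eqP;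
  rewrite ?cReJ ?cImJ //= oppr0. Qed.

Lemma cutexp_cemb (M : R) (t x : 'cV[R]_d) : supp M x -> cutexp M (cemb t) x = e2pi (dot t x).
Proof.
move=> sx; rewrite cutexp_in //.
have -> : lin (cemb t) x = (0 +i* (2 * pi * dot t x))%C.
  rewrite /lin /dot mulr_sumr; apply: complex_eqP; rewrite ?cRe_sum ?cIm_sum /=.
    by rewrite big1 // => j _; rewrite mxE cReM /=; ring.
  by apply: eq_bigr => j _; rewrite mxE cImM /=; ring.
by rewrite /cexp /= expR0 !mul1r.
Qed.
End real_frequencies.

Section frame_strip.
Variables (R : realType) (d : nat) (A : 'M[int]_d) (alpha : 'cV[int]_d -> complex R).
Hypothesis alpha0 : alpha 0 = 1.

Lemma frame_elt_strip w : frame_elt A alpha (strip w) = frame_elt A alpha w.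
Proof.
have [h1 h2] : freq R A (strip w) = freq R A w /\
    \prod_(l <- strip w) alpha l = \prod_(l <- w) alpha l.
  elim: w => [|l w [IH1 IH2]] //=.
  case: ifPn => [/andP[/eqP s0 /eqP ->]|_]; last by rewrite !freq_cons !big_cons IH1 IH2.
  rewrite freq_cons big_cons -IH1 -IH2 s0 freq_nil mulmx0 addr0 alpha0 mul1r; split => //.
  by apply/matrixP => i j; rewrite !mxE.
by apply/funext => x; rewrite /frame_elt h1 h2.
Qed.
End frame_strip.

Theorem theorem1p3 (R : realType) (d : nat) (A : 'M[int]_d)
  (B : seq 'cV[int]_d) (mu : probability (Rd R d) R)
  (L : seq 'cV[int]_d) (alpha : 'cV[int]_d -> complex R) :
  expansive R A ->
  uniq B -> 0 \in B ->
  (* mu = mu(A,B) is the self-affine measure: the Borel probability measure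
     with mu(E) = 1/N sum_b mu(tau_b^{-1}(E)) *)
  (forall E : set (Rd R d), measurable E ->
     mu E = ((((size B)%:R)^-1)%:E * \sum_(b <- B) mu (tau (R:=R) A b @^-1` E))%E) ->
  (* no overlap *)
  (forall b b', b \in B -> b' \in B -> b != b' ->
     mu (tau (R:=R) A b @` attractor (R:=R) A B `&` tau (R:=R) A b' @` attractor (R:=R) A B) = 0%E) ->
  uniq L -> 0 \in L ->
  (* (i) *)
  alpha 0 = 1 ->
  (* (ii) T^* T = I_N *)
  (map_mx Num.conj (Tmat A B L alpha))^T *m Tmat A B L alpha = 1%:M ->
  (* (iii) *)
  (forall h : 'cV[complex R]_d -> (complex R)^o,
     (forall z, differentiable h z) ->
     (forall t : 'cV[R]_d, 0 <= h (cemb t) <= 1) ->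
     h 0 = 1 ->
     (forall t : 'cV[R]_d,
        \sum_(l <- L) (`|alpha l| ^+ 2
                       * `|mB B (invmx (imat R A)^T *m (t - ivec R l))| ^+ 2
                       * h (cemb (invmx (imat R A)^T *m (t - ivec R l))))
        = h (cemb t)) ->
     forall z, h z = 1) ->
  parseval_frame mu (Omega L) (frame_elt A alpha).
Proof.
move=> hA _ B_0 mu_inv _ uL L0 a0 TT h_unique.
have uA := expansive_unitmx hA.
have B0 : B != [::] by apply/eqP => h; rewrite h in B_0.
pose F := frame_elt A alpha; pose ws := words L.
have FL2 w : L2 mu (F w) by exact: L2_frame_elt.
have bessel n v : L2 mu v -> bessel_sum mu ws F n v <= nrm2 mu v by exact: (frame_sum_le uA B0
  mu_inv TT).
have Qnd v : L2 mu v -> nondecreasing_seq ((bessel_sum mu ws F) ^~ v) by exact: (frame_sum_nd uA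
  B0 mu_inv L0 a0).
pose e (t : 'cV[R]_d) (x : 'cV[R]_d) : complex R := e2pi (dot t x).
have Le t : L2 mu (e t) by exact: L2_e2pi.
have ne t : nrm2 mu (e t) = 1.
  rewrite /nrm2 /e; under eq_Rintegral do rewrite cabs2_e2pi.
  by rewrite Rintegral_cst // measure_setT1 mulr1.
have [M0 hM0] := invariant_bounded_support B0 mu_inv hA.
(* [M0] comes without a sign, and the exponential bounds ask for a nonnegative radius. *)
pose M := Num.max M0 0.
have M_ge0 : 0 <= M by rewrite le_max lexx orbT.
have mS : measurable (supp M : set (Rd R d)) by exact: measurable_supp.
have S1 : mu (supp M : set (Rd R d)) = 1%E.
  apply/eqP; rewrite eq_le probability_le1 //= -hM0; apply: le_measure; rewrite ?inE //.
    exact: measurable_l1norm_le.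
  by move=> x /= h; rewrite /supp /= le_max h.
(* The cut-off exponential and [e t] agree on a set of full measure, so they have the same
   coefficients. *)
have QE t : bessel_lim mu ws F (cutexp M (cemb t)) = bessel_lim mu ws F (e t).
  congr (limn _); apply/funext => n; apply: eq_bigr => w _; congr cabs2.
  apply: (inner_eq_on mS S1); [exact: cmeas_cutexp|exact: cmeas_e2pi|exact: L2_cmeas (FL2 w)|].
  by move=> x sx; exact: cutexp_cemb.
pose h := hlim mu ws F M.
have hE t : h (cemb t) = ((bessel_lim mu ws F (e t))%:C)%C.
  by rewrite /h /hlim conj_cemb (gram_lim_diag FL2 bessel Qnd) ?QE //; exact: L2_cutexp.
have Q_e t : bessel_lim mu ws F (e t) = 1.
  have h1 : h (cemb t) = 1.
    apply: h_unique.
    - by move=> z; exact: (hlim_entire FL2 bessel Qnd).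
    - move=> s; rewrite hE ler0c -[1]/((1%:C)%C) lecR -(ne s) (bessel_lim_le bessel Qnd) // andbT.
      exact: le_trans (bessel_sum_ge0 _ _ _ 0 _) (bessel_sum_le_lim bessel Qnd 0 (Le s)).
    (* At frequency 0 the Bessel bound gives at most 1, and level 0 already gives 1: its only word
       is empty and pairs [e 0] with the constant 1. *)
    - have -> : 0 = cemb 0 :> 'cV[complex R]_d by apply/matrixP => i j; rewrite !mxE.
      rewrite hE; apply: complex_eqP => //=; apply/eqP.
      rewrite eq_le -{1}(ne 0) (bessel_lim_le bessel Qnd) //=.
      apply: le_trans (bessel_sum_le_lim bessel Qnd 0 (Le 0)).
      rewrite /bessel_sum /ws /= big_seq1 /inner.
      have -> : (fun x => e 0 x * Num.conj (F [::] x)) = (fun=> 1).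
        by apply/funext => x; rewrite /e dot0l e2pi0 /F frame_elt_nil conjC1 mulr1.
      by rewrite /cint /= !Rintegral_cst // measure_setT1 /= mulr1 mul0r /cabs2 /= expr1n expr0n
        addr0.
    move=> s; rewrite hE.
    have c1 := bessel_sum_cvg bessel Qnd (Le s).
    have c2 : \sum_(l <- L) cabs2 (alpha l) * cabs2 (mB B (invmx (imat R A)^T *m (s - ivec R
      l))) *
         bessel_sum mu ws F n (e (invmx (imat R A)^T *m (s - ivec R l))) @[n --> \oo] -->
       \sum_(l <- L) cabs2 (alpha l) * cabs2 (mB B (invmx (imat R A)^T *m (s - ivec R l))) *
         bessel_lim mu ws F (e (invmx (imat R A)^T *m (s - ivec R l))).
      apply: cvg_big => [|l _]; first exact: add_continuous.
      by apply: cvgM; [exact: cvg_cst|exact: bessel_sum_cvg].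
    have c3 : bessel_sum mu ws F n.+1 (e s) @[n --> \oo] --> bessel_lim mu ws F (e s) by rewrite
      -(cvg_shiftS (fun n => bessel_sum mu ws F n (e s))) in c1; exact: c1.
    have c4 n : bessel_sum mu ws F n.+1 (e s) =
       \sum_(l <- L) cabs2 (alpha l) * cabs2 (mB B (invmx (imat R A)^T *m (s - ivec R l))) *
         bessel_sum mu ws F n (e (invmx (imat R A)^T *m (s - ivec R l))).
      exact: (frame_sum_e2pi L alpha uA B0 mu_inv).
    move: c3; under eq_fun do rewrite c4.
    move=> /(cvg_unique _ c2) <- //.
    rewrite rmorph_sum /=; apply: eq_bigr => l _.
    by rewrite hE !rmorphM /= !cabs2_norm.
  by move: h1; rewrite hE => /(congr1 (@complex.Re R)).
have Ve t : parseval_at mu ws F (e t) by split => //; rewrite /defect ne Q_e subrr.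
move=> v hv.
have [_] := trigonometric_dense (V := parseval_at mu ws F)
  (parseval_atD FL2 bessel Qnd) (parseval_atZ FL2 bessel Qnd) (parseval_at_lim FL2 bessel Qnd)
  Ve hv.
move=> /eqP; rewrite subr_eq0 => /eqP nv.
rewrite nrm2E // nv.
apply: esum_Omega => //.
- by move=> w; exact: cabs2_ge0.
- by move=> w; rewrite frame_elt_strip.
- exact: Qnd.
- exact: bessel_sum_cvg.
Qed.
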